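(* Let $G$ be a second-countable (Hausdorff) topological group. Then the following statements are equivalent. (1) $G$ is amenable. (2) $G$ admits a fully supported, regular Borel probability measure $\mu$ such that the sequence of convolution powers $(\mu^{n})_{n\in\mathbb{N}}$ UEB-converges to invariance over $G$. (3) $G$ admits a Borel probability measure $\mu$ such that $(\mu^{n})_{n\in\mathbb{N}}$ UEB-converges to invariance over $G$.
   Context: For a topological group $G$ and $g\in G$ let $\lambda_g\colon G\to G,\ x\mapsto gx$. A function $f\colon G\to\mathbb{C}$ is right-uniformly continuous if for every $\varepsilon>0$ there is a neighbourhood $U$ of the neutral element such that $|f(x)-f(y)|\le\varepsilon$ whenever $xy^{-1}\in U$. $\mathrm{RUCB}(G)$ is the commutative unital $C^*$-algebra of all bounded right-uniformly continuous functions $G\to\mathbb{C}$ (pointwise operations, supremum norm). $\mathrm{RUEB}(G)$ is the collection of all UEB sets, i.e. subsets $H\subseteq \mathrm{RUCB}(G)$ that are $\|\cdot\|_\infty$-bounded and right-uniformly equicontinuous: for every $\varepsilon>0$ there is a neighbourhood $U$ of the neutral element with $|f(x)-f(y)|\le\varepsilon$ for all $f\in H$ and all $x,y\in G$ with $xy^{-1}\in U$. $\mathrm{M}(G)$ is the set of states on $\mathrm{RUCB}(G)$ (positive linear functionals $\mu$ with $\mu(\mathbf 1)=1$). $G$ is amenable if there is $\mu\in\mathrm{M}(G)$ with $\mu(f\circ\lambda_g)=\mu(f)$ for all $f\in\mathrm{RUCB}(G)$, $g\in G$. A net $(\mu_i)_{i\in I}$ in $\mathrm{M}(G)$ UEB-converges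 to invariance over $G$ if for all $g\in G$ and $H\in\mathrm{RUEB}(G)$ one has $\sup_{f\in H}|\mu_i(f\circ\lambda_g)-\mu_i(f)|\to 0$. A Borel probability measure $\mu$ on $G$ is identified with the state $f\mapsto\int f\,d\mu$. A Borel probability measure $\mu$ on a Hausdorff space $T$ is regular if $\mu(B)=\sup\{\mu(K)\mid K\subseteq B,\ K\text{ compact}\}$ for every Borel set $B$; its support is $\mathrm{spt}(\mu)=\{x\in T\mid \mu(U)>0\text{ for every open }U\ni x\}$; it is fully supported if $\mathrm{spt}(\mu)=T$. The convolution of Borel probability measures $\mu,\nu$ on $G$ is $(\mu\nu)(B)=(\mu\otimes\nu)(\{(x,y)\in G\times G\mid xy\in B\})$ for $B\subseteq G$ Borel, and $\mu^n$ denotes the $n$-th convolution power. *)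

(* Defs.v *)
From HB Require Import structures.
From mathcomp Require Import all_boot all_order all_algebra.
From mathcomp Require Import complex.
From mathcomp Require Import all_classical all_reals all_analysis.
From mathcomp Require Import measurable_realfun.

Set Implicit Arguments.
Unset Strict Implicit.
Unset Printing Implicit Defensive.

Import Order.TTheory GRing.Theory Num.Theory.
Import numFieldNormedType.Exports.

Local Open Scope classical_set_scope.
Local Open Scope ring_scope.
Local Open Scope complex_scope.

Notation normc := ComplexField.Normc.normc.
Local Notation Re := complex.Re.
Local Notation Im := complex.Im.

HB.mixin Record isTopologicalGroup G & Group G & PointedTopological G := {
  mulg_continuous : continuous (fun xy : G * G => (xy.1 * xy.2)%g) ;
  invg_continuous : continuous (fun x : G => (x^-1)%g)
}.

(* The base point is only there because measurable spaces are pointed in the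
   library; it plays no role and need not be the neutral element. *)
#[short(type="topologicalGroupType")]
HB.structure Definition TopologicalGroup :=
  {G of Group G & PointedTopological G & isTopologicalGroup G}.

Section RUCB.
Context (R : realType) (G : topologicalGroupType).
Implicit Types (f : G -> R[i]) (H : set (G -> R[i])).

Definition ltrans (g : G) : G -> G := fun x => (g * x)%g.

Definition right_uniformly_equicontinuous H := forall eps : R, 0 < eps ->
  exists2 U, nbhs (1%g : G) U & forall f x y, H f -> U (x * y^-1)%g ->
    normc (f x - f y) <= eps.

Definition right_uniformly_continuous f := forall eps : R, 0 < eps ->
  exists2 U, nbhs (1%g : G) U & forall x y, U (x * y^-1)%g ->
    normc (f x - f y) <= eps.

Definition RUCB : set (G -> R[i]) := [set f |
  (exists M : R, forall x, normc (f x) <= M) /\ right_uniformly_continuous f].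

Definition RUEB : set (set (G -> R[i])) := [set H |
  [/\ H `<=` RUCB,
      exists M : R, forall f x, H f -> normc (f x) <= M &
      right_uniformly_equicontinuous H]].

(* A functional on RUCB is represented by a function on all of G -> R[i], of
   which only the values on RUCB are constrained or ever used.  The order of
   R[i] makes 0 <= z mean that z is a nonnegative real. *)
Record state := State {
  state_fun :> (G -> R[i]) -> R[i] ;
  stateP : forall (a : R[i]) f h, RUCB f -> RUCB h ->
    state_fun (fun x => a * f x + h x) = a * state_fun f + state_fun h ;
  state_ge0 : forall f, RUCB f -> (forall x, 0 <= f x) -> 0 <= state_fun f ;
  state1 : state_fun (fun=> 1) = 1
}.

Definition amenable := exists mu : state,
  forall f g, RUCB f -> mu (f \o ltrans g) = mu f.

(* The suprema are taken over bounded subsets of [0, +oo[, and sup set0 = 0. *)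
Definition UEB_converges_to_invariance (I : Type) (F : set_system I)
    (mu : I -> state) :=
  forall (g : G) (H : set (G -> R[i])), RUEB H ->
    sup [set normc (mu i (f \o ltrans g) - mu i f) | f in H] @[i --> F] --> (0 : R).

End RUCB.

Notation borel T := (g_sigma_algebraType (@open T)).

Section borel_measure.
Context (R : realType) (T : ptopologicalType) (mu : probability (borel T) R).

Definition regular_measure := forall B : set (borel T), measurable B ->
  mu B = ereal_sup [set mu K | K in [set K : set T | compact K /\ K `<=` B]].

Definition support : set T :=
  [set x | forall U : set T, open U -> U x -> (0 < mu U)%E].

Definition fully_supported := support = setT.

End borel_measure.

Section measure_state.
Context (R : realType) (G : topologicalGroupType).
Implicit Types (f : G -> R[i]).

Lemma continuous_borel_measurable (f : G -> R) :
  continuous f -> measurable_fun setT (f : borel G -> R).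
Proof.
move=> cf; apply: (measurability _ (RGenOInfty.measurableE R)).
move=> _ [_ [x ->] <-]; rewrite setTI; apply: sub_sigma_algebra.
apply: open_comp => [y _|]; first exact: cf.
exact: rray_open.
Qed.

Lemma ler_Re_normc (z : R[i]) : `|Re z| <= normc z.
Proof. by case: z => a b /=; rewrite -sqrtr_sqr ler_wsqrtr// lerDl sqr_ge0. Qed.

Lemma ler_Im_normc (z : R[i]) : `|Im z| <= normc z.
Proof. by case: z => a b /=; rewrite -sqrtr_sqr ler_wsqrtr// lerDr sqr_ge0. Qed.

Section part.
Variable p : R[i] -> R.
Hypothesis pB : {morph p : z w / z - w}.
Hypothesis p_normc : forall z, `|p z| <= normc z.

Lemma RUCB_part_continuous f : RUCB f -> continuous (p \o f).
Proof.
move=> [_ uf] y; apply/cvgrPdist_le => /= e e0.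
have [U U1 fU] := uf _ e0.
have : (fun x : G => x * y^-1)%g @ y --> (1%g : G).
  rewrite -(mulgV y).
  apply: (@continuous_comp _ _ _ (fun x => (x, y^-1)%g)
    (fun xy : G * G => (xy.1 * xy.2)%g)); last exact: mulg_continuous.
  by apply: cvg_pair => //=; exact: cvg_cst.
move=> /(_ _ U1); rewrite !nbhs_simpl/=; apply: filterS => x Ux.
by rewrite distrC -pB (le_trans (p_normc _))// fU.
Qed.

Lemma RUCB_part_integrable (mu : probability (borel G) R) f : RUCB f ->
  mu.-integrable setT (EFin \o (p \o f)).
Proof.
move=> Rf; apply: measurable_bounded_integrable => //.
- by rewrite (le_lt_trans (probability_le1 mu _))// ltry.
- by apply: continuous_borel_measurable; exact: RUCB_part_continuous.
- have [[M fM] _] := Rf; exists M; split; first exact: num_real.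
  by move=> N MN x _ /=; rewrite (le_trans (p_normc _))// (le_trans (fM x))// ltW.
Qed.

End part.

Let ReB : {morph @Re R : z w / z - w}. Proof. by case=> ? ? [? ?]. Qed.
Let ImB : {morph @Im R : z w / z - w}. Proof. by case=> ? ? [? ?]. Qed.
Let ReD : {morph @Re R : z w / z + w}. Proof. by case=> ? ? [? ?]. Qed.
Let ImD : {morph @Im R : z w / z + w}. Proof. by case=> ? ? [? ?]. Qed.

Variable mu : probability (borel G) R.

Definition integralC f : R[i] :=
  (\int[mu]_x Re (f x)) +i* (\int[mu]_x Im (f x)).

Let intRe f : RUCB f -> mu.-integrable setT (EFin \o (@Re R \o f)).
Proof. by apply: RUCB_part_integrable; [exact: ReB|exact: ler_Re_normc]. Qed.

Let intIm f : RUCB f -> mu.-integrable setT (EFin \o (@Im R \o f)).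
Proof. by apply: RUCB_part_integrable; [exact: ImB|exact: ler_Im_normc]. Qed.

Lemma integralC_linear (a : R[i]) f h : RUCB f -> RUCB h ->
  integralC (fun x => a * f x + h x) = a * integralC f + integralC h.
Proof.
case: a => a b Rf Rh.
have iZ c (p : G -> R) : mu.-integrable setT (EFin \o p) ->
  mu.-integrable setT (EFin \o (fun x => c * p x)).
  by move=> ip; exact: (@integrableZl _ _ _ mu setT measurableT c (EFin \o p) ip).
rewrite /integralC.
have -> : \int[mu]_x Re ((a +i* b) * f x + h x) =
    a * \int[mu]_x Re (f x) - b * \int[mu]_x Im (f x) + \int[mu]_x Re (h x).
  rewrite -!RintegralZl//; [|by (exact: intIm || exact: intRe)..].
  rewrite -RintegralB//; [|exact: (iZ _ _ (intRe Rf))|exact: (iZ _ _ (intIm Rf))].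
  rewrite -RintegralD//; last exact: intRe.
    by apply: eq_Rintegral => x _; case: (f x) (h x) => ? ? [? ?].
  rewrite (_ : _ \o _ = (fun x => (a * Re (f x))%:E - (b * Im (f x))%:E)%E)//.
  by apply: integrableB => //; [exact: (iZ _ _ (intRe Rf))|exact: (iZ _ _ (intIm Rf))].
have -> : \int[mu]_x Im ((a +i* b) * f x + h x) =
    a * \int[mu]_x Im (f x) + b * \int[mu]_x Re (f x) + \int[mu]_x Im (h x).
  rewrite -!RintegralZl//; [|by (exact: intIm || exact: intRe)..].
  rewrite -RintegralD//; [|exact: (iZ _ _ (intIm Rf))|exact: (iZ _ _ (intRe Rf))].
  rewrite -RintegralD//; last exact: intIm.
    by apply: eq_Rintegral => x _; case: (f x) (h x) => ? ? [? ?].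
  rewrite (_ : _ \o _ = (fun x => (a * Im (f x))%:E + (b * Re (f x))%:E)%E)//.
  by apply: integrableD => //; [exact: (iZ _ _ (intIm Rf))|exact: (iZ _ _ (intRe Rf))].
by [].
Qed.

Lemma integralC_ge0 f : RUCB f -> (forall x, 0 <= f x) -> 0 <= integralC f.
Proof.
move=> _ f0; rewrite lecE /=; apply/andP; split.
  under eq_Rintegral do rewrite ger0_Im//.
  by rewrite Rintegral_cst// mul0r.
by apply: Rintegral_ge0 => x _; move: (f0 x); rewrite lecE => /andP[].
Qed.

Lemma integralC1 : integralC (fun=> 1) = 1.
Proof.
have m1 : mu setT = 1%E := probability_setT mu.
rewrite /integralC/= !Rintegral_cst//; set u := fine _.
suff -> : u = 1 by rewrite mul0r mulr1.
by rewrite /u [X in fine X]m1.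
Qed.

Definition measure_state : state R G :=
  State integralC_linear integralC_ge0 integralC1.

End measure_state.

Section convolution.
Context (R : realType) (G : topologicalGroupType).

(* Second countability makes the Borel sigma-algebra of G * G the product of
   those of G, which is where the product measure is defined. *)
Hypothesis scG : @second_countable G.

Definition mulg_pair (xy : borel G * borel G) : borel G :=
  ((xy.1 : G) * (xy.2 : G))%g.

Lemma measurable_mulg_pair : measurable_fun setT mulg_pair.
Proof.
apply: (@measurability _ _ _ _ setT mulg_pair (@open G)) => //.
move=> _ [U oU <-]; rewrite setTI.
have [B cB [Bo Bb]] := scG.
have -> : mulg_pair @^-1` U = \bigcup_(p in [set p : set G * set G |
    (B `*` B) p /\ p.1 `*` p.2 `<=` mulg_pair @^-1` U]) (p.1 `*` p.2).
  apply/seteqP; split => [[x y] Uxy|[x y] [p [_ pU] pxy]]; last exact: pU.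
  have /(mulg_continuous (x, y)) : nbhs (x * y)%g U by exact: open_nbhs_nbhs.
  move=> [[V W]/= [nV nW] VWU].
  have [V' [BV' V'x] V'V] := Bb x _ nV.
  have [W' [BW' W'y] W'W] := Bb y _ nW.
  exists (V', W') => //; split => // -[u v] [/= V'u W'v].
  by apply: (VWU (u, v)); split; [exact: V'V|exact: W'W].
rewrite bigcup_set_type; apply: countable_bigcupT_measurable.
  rewrite (eq_countable (card_setT _)).
  apply: sub_countable (countableX cB cB).
  by apply: subset_card_le => p [].
move=> [[V W]/=]; rewrite inE/= => -[[BV BW] _].
by apply: measurableX; apply: sub_sigma_algebra; exact: Bo.
Qed.

Definition mulg_mfun : {mfun (borel G * borel G)%type >-> borel G} :=
  HB.pack mulg_pair (isMeasurableFun.Build _ _ _ _ mulg_pair measurable_mulg_pair).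

Definition convolution (mu nu : probability (borel G) R)
  : probability (borel G) R := distribution (mu \x nu)%E mulg_mfun.

Lemma convolutionE (mu nu : probability (borel G) R) (B : set (borel G)) :
  convolution mu nu B = (mu \x nu)%E [set xy | B (mulg_pair xy)].
Proof. by []. Qed.

(* The zeroth power is the Dirac measure at the neutral element. *)
Definition convolution_power (mu : probability (borel G) R) (n : nat)
  : probability (borel G) R := iter n (convolution mu) \d_(1%g : borel G).

End convolution.

(* Main.v *)
From HB Require Import structures.
Require Import Defs.
From mathcomp Require Import all_boot all_order all_algebra.
From mathcomp Require Import complex.
From mathcomp Require Import all_classical all_reals all_analysis.
From mathcomp Require Import measurable_realfun finmap ring lra.

(** (1) => (2): Let [N] be a length function defining the topology
    (Birkhoff-Kakutani); bounded [N]-Lipschitz functions uniformly approximate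
    every UEB set.  The pairs (function, translation) range over a compact
    convex set for pointwise convergence, so a minimax argument turns an
    invariant mean into finitely supported probabilities that are almost
    invariant uniformly over a Lipschitz ball.  Following Kaimanovich-Vershik,
    put [mu = \sum_i 2^-(i+1) nu_i] where [nu_i] is almost invariant under all
    words of length at most [4^i] in a dense sequence and the atoms of the
    previous [nu_j].  In [mu^n], the first factor drawn from some [nu_i] with
    [i >= m] absorbs all the factors to its left, and the event that no such
    factor occurs among the first [4^m] has probability at most [2^-m].
    Being a countable sum of Dirac masses at a dense set, [mu] is regular and
    fully supported.
    (3) => (1): take the limit of the states [mu^n] along an ultrafilter. *)

Set Implicit Arguments.
Unset Strict Implicit.
Unset Printing Implicit Defensive.

Import Order.TTheory GRing.Theory Num.Theory.
Import numFieldNormedType.Exports.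

Local Open Scope classical_set_scope.
Local Open Scope ring_scope.

(** * Length functions *)

Lemma cvg_half (R : realType) : (2^-1 ^+ n : R) @[n --> \oo] --> (0 : R).
Proof. by apply: cvg_expr; rewrite ger0_norm ?invr_ge0// invf_lt1// ltr1n. Qed.

Section length.
Context (R : realType) (G : topologicalGroupType).

Record length_function (N : G -> R) : Prop := LengthFunction {
  length1 : N 1%g = 0 ;
  lengthM : forall x y, N (x * y)%g <= N x + N y ;
  lengthV : forall x, N x^-1%g = N x ;
  length_cvg1 : forall e, 0 < e -> \forall x \near (1%g : G), N x < e }.

Lemma length_ge0 N : length_function N -> forall x, 0 <= N x.
Proof.
move=> [N1 NM NV _] x; have := NM x x^-1%g.
by rewrite mulgV N1 NV; lra.
Qed.

Section chain.
Variable V : nat -> set G.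
Hypothesis V0 : V 0%N = setT.
Hypothesis VS : forall n x y z, V n.+1 x -> V n.+1 y -> V n.+1 z ->
  V n (x * y * z)%g.
Hypothesis Vnbhs : forall n, nbhs 1%g (V n).

Let V1 n : V n 1%g. Proof. exact: nbhs_singleton. Qed.

Let Vle m n : (m <= n)%N -> V n `<=` V m.
Proof.
move=> /subnK <-; elim: (n - m)%N => [//|k IH] x Vx; apply: IH.
by rewrite -(mulg1 x) -(mulg1 (x * 1)%g); apply: VS.
Qed.

(** A pair [(n, x)] of a chain stands for a factor [x] taken from [V n], a step of cost 2^-n. *)
Definition chain_weight (s : seq (nat * G)) : R := \sum_(p <- s) 2^-1 ^+ p.1.
Definition chain_prod (s : seq (nat * G)) : G := (\prod_(p <- s) p.2)%g.

Lemma chain_weight_ge0 s : 0 <= chain_weight s.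
Proof. by apply: sumr_ge0 => p _; rewrite exprn_ge0// invr_ge0. Qed.

(** Cut at the first [p] where the weight accumulated from [b] reaches [a]; if this never happens,
    the last element serves as [p]. The offset [b] is what the induction varies. *)
Lemma chain_split (a b : R) s : 0 < a -> s != [::] -> b < a ->
  b + chain_weight s < a + a ->
  exists s1 p s2, [/\ s = s1 ++ p :: s2, b + chain_weight s1 < a &
    chain_weight s2 < a].
Proof.
move=> a0; elim: s b => // p s IH b _ ba; rewrite /chain_weight big_cons => H.
have [pa|pa] := ltP (b + 2^-1 ^+ p.1) a.
  have [->|s0] := eqVneq s [::].
    by exists [::], p, [::]; split; rewrite // /chain_weight big_nil// addr0.
  have [|s1 [q [s2 [-> H1 H2]]]] := IH (b + 2^-1 ^+ p.1) s0 pa.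
    by rewrite -addrA.
  exists (p :: s1), q, s2; split => //.
  by rewrite /chain_weight big_cons addrA.
exists [::], p, s; split => //; first by rewrite /chain_weight big_nil addr0.
by move: H pa; rewrite /chain_weight; lra.
Qed.

(* Cutting a chain where its weight passes half of the total leaves a product
   of three factors, each in the next smaller neighbourhood. *)
Lemma chain_prod_in k s : (forall p, p \in s -> V p.1 p.2) ->
  chain_weight s < 2^-1 ^+ k -> V k (chain_prod s).
Proof.
have [n] := ubnP (size s); elim: n => // n IH in k s * => sn sV sk.
have [->|s0] := eqVneq s [::]; first by rewrite /chain_prod big_nil; exact: V1.
have hk : (2^-1 ^+ k : R) = 2^-1 ^+ k.+1 + 2^-1 ^+ k.+1 by rewrite exprS; lra.
have [|||s1 [p [s2 [sE H1 H2]]]] := @chain_split (2^-1 ^+ k.+1) 0 s _ s0.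
- by rewrite exprn_gt0// invr_gt0.
- by rewrite exprn_gt0// invr_gt0.
- by rewrite add0r -hk.
rewrite add0r in H1.
have szE : (size s = size s1 + (size s2).+1)%N by rewrite sE size_cat.
rewrite sE /chain_prod big_cat big_cons/= mulgA; apply: VS.
- apply: IH => //; first by rewrite -ltnS (leq_trans _ sn)// szE ltnS addnS ltnS leq_addr.
  by move=> q qs; apply: sV; rewrite sE mem_cat qs.
- apply: (@Vle _ p.1); last by apply: sV; rewrite sE mem_cat inE eqxx orbT.
  have : (2^-1 : R) ^+ p.1 < 2^-1 ^+ k.
    apply: le_lt_trans sk; rewrite sE /chain_weight big_cat big_cons/=.
    have := chain_weight_ge0 s1; have := chain_weight_ge0 s2.
    by rewrite /chain_weight; lra.
  by rewrite ltr_iXn2l// ?invr_gt0// invf_lt1// ltr1n.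
- apply: IH => //; first by rewrite -ltnS (leq_trans _ sn)// szE ltnS addnS ltnS leq_addl.
  by move=> q qs; apply: sV; rewrite sE mem_cat inE qs !orbT.
Qed.

Let chains x := [set s : seq (nat * G) | (forall p, p \in s -> V p.1 p.2) /\ chain_prod s = x].
(** The cheapest factorisation of [x]; [V 0 = setT] provides the one-step chain [(0, x)] for every
    [x], so the infimum is over a nonempty set. *)
Definition chain_length x : R := inf [set chain_weight s | s in chains x].

Let chains_lb x : has_inf [set chain_weight s | s in chains x].
Proof.
split; last by exists 0 => _ [s _ <-]; exact: chain_weight_ge0.
exists (chain_weight [:: (0%N, x)]); exists [:: (0%N, x)] => //.
split; last by rewrite /chain_prod big_seq1.
by move=> p; rewrite inE => /eqP ->; rewrite /= V0.
Qed.

Lemma chain_length_ge0 x : 0 <= chain_length x.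
Proof.
by apply: lb_le_inf => [|_ [s _ <-]]; [case: (chains_lb x)|exact: chain_weight_ge0].
Qed.

Lemma chain_length_le n x : V n x -> chain_length x <= 2^-1 ^+ n.
Proof.
move=> Vx; apply: ge_inf; first by case: (chains_lb x).
exists [:: (n, x)]; last by rewrite /chain_weight big_seq1.
split; last by rewrite /chain_prod big_seq1.
by move=> p; rewrite inE => /eqP ->.
Qed.

Lemma chain_lengthM x y : chain_length (x * y)%g <= chain_length x + chain_length y.
Proof.
apply/ler_addgt0Pr => e e0.
have e2 : 0 < e / 2 by rewrite divr_gt0.
have [_ [s [sV sx] <-] sl] := inf_adherent e2 (chains_lb x).
have [_ [t [tV ty] <-] tl] := inf_adherent e2 (chains_lb y).
apply: (@le_trans _ _ (chain_weight (s ++ t))).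
  apply: ge_inf; first by case: (chains_lb (x * y)%g).
  exists (s ++ t) => //; split; last by rewrite -sx -ty /chain_prod big_cat.
  by move=> p; rewrite mem_cat => /orP[/sV|/tV].
rewrite /chain_weight big_cat/= -/(chain_weight s) -/(chain_weight t).
by move: sl tl; rewrite -/(chain_length x) -/(chain_length y); lra.
Qed.

Lemma chain_length_lt k x : chain_length x < 2^-1 ^+ k -> V k x.
Proof.
move=> H; have e0 : 0 < 2^-1 ^+ k - chain_length x by rewrite subr_gt0.
have [_ [s [sV sx] <-] sl] := inf_adherent e0 (chains_lb x).
rewrite -sx; apply: chain_prod_in => //.
by move: sl; rewrite -/(chain_length x); lra.
Qed.

(** The [V n] need not be symmetric, so invariance under inversion is obtained by adding the value
    at the inverse; subadditivity survives because inversion reverses products and real addition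
    commutes. *)
Lemma chain_length_function :
  length_function (fun x => chain_length x + chain_length x^-1%g).
Proof.
have half (e : R) : 0 < e -> exists n, 2^-1 ^+ n < e.
  move: (@cvg_half R) => /cvgrPdist_lt H /H[n _ /(_ n (leqnn n))].
  by rewrite /= sub0r normrN ger0_norm ?exprn_ge0 ?invr_ge0//; exists n.
split.
- rewrite invg1; suff -> : chain_length 1%g = 0 by rewrite addr0.
  apply/le_anti; rewrite chain_length_ge0 andbT.
  apply/ler_addgt0Pr => e e0; have [n ne] := half _ e0.
  by rewrite add0r (le_trans _ (ltW ne))// chain_length_le.
- move=> x y; rewrite invgM.
  by have := chain_lengthM x y; have := chain_lengthM y^-1%g x^-1%g; lra.
- by move=> x; rewrite invgK addrC.
- move=> e e0; have [n ne] := half (e / 2) (divr_gt0 e0 (ltr0Sn _ 1)).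
  have nV : \forall x \near (1%g : G), V n x^-1%g.
    apply: (@invg_continuous G (1%g : G)); rewrite /= invg1; exact: Vnbhs.
  near=> x.
  have : V n x by near: x; exact: Vnbhs.
  have : V n x^-1%g by near: x.
  by move=> /chain_length_le + /chain_length_le; lra.
Unshelve. all: by end_near. Qed.

End chain.

Lemma nbhs_mulg3 (U : set G) : nbhs 1%g U ->
  exists2 W, nbhs 1%g W & forall x y z, W x -> W y -> W z -> U (x * y * z)%g.
Proof.
have mul2 (A : set G) : nbhs 1%g A ->
    exists2 W, nbhs 1%g W & forall x y, W x -> W y -> A (x * y)%g.
  rewrite -{1}(mulg1 1%g) => /(mulg_continuous (1%g, 1%g)) [[P Q] /= [nP nQ] PQ].
  exists (P `&` Q); first exact: filterI.
  by move=> x y [Px _] [_ Qy]; apply: (PQ (x, y)).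
move=> /mul2[W1 nW1 W1U]; have [W2 nW2 W2W1] := mul2 _ nW1.
exists (W2 `&` W1); first exact: filterI.
by move=> x y z [Wx _] [Wy _] [_ Wz]; apply: W1U => //; exact: W2W1.
Qed.

(* Birkhoff-Kakutani *)
Lemma exists_length_function : @second_countable G ->
  exists N : G -> R, length_function N /\
    forall U, nbhs 1%g U -> exists2 e, 0 < e & forall x, N x < e -> U x.
Proof.
move=> [B cB [Bo Bb]]; have /pfcard_geP[B0|[b]] := cB.
  by have [W []] := Bb 1%g _ filterT; rewrite B0.
(* Members of the base that miss [1] are replaced by [setT], so that every [base n] is a
   neighbourhood of [1]. *)
pose base n := if `[< b n 1%g >] then b n else setT.
have nbase n : nbhs 1%g (base n).
  rewrite /base; case: asboolP => [bn|_]; last exact: filterT.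
  by apply: open_nbhs_nbhs; split => //; apply: Bo; exact: funS.
have /choice[shrink shrinkP] : forall A : set G, exists W, nbhs 1%g A -> nbhs 1%g W /\
    forall x y z, W x -> W y -> W z -> A (x * y * z)%g.
  move=> A; have [/nbhs_mulg3[W nW WA]|nA] := pselect (nbhs 1%g A).
    by exists W.
  by exists A.
(* Triple products from [V n.+1] lie in [V n], as the chain argument requires, and in [base n],
   which makes the [V n] shrink to [1]. *)
pose V := fix V n := if n is n'.+1 then shrink (V n' `&` base n') else setT.
have nV n : nbhs 1%g (V n).
  elim: n => [|n IH]; first exact: filterT.
  by apply: (shrinkP _ _).1; apply: filterI.
have V1 n : V n 1%g by exact: nbhs_singleton.
have VSb n x y z : V n.+1 x -> V n.+1 y -> V n.+1 z -> (V n `&` base n) (x * y * z)%g.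
  by apply: (shrinkP _ _).2; apply: filterI.
have VS n x y z : V n.+1 x -> V n.+1 y -> V n.+1 z -> V n (x * y * z)%g.
  by move=> Vx Vy Vz; have [] := VSb n x y z Vx Vy Vz.
have V0 : V 0%N = setT by [].
exists (fun x => chain_length V x + chain_length V x^-1%g); split.
  exact: chain_length_function.
move=> U /Bb[W [BW W1] WU].
have [n _ bn] : (range b) W by exact: surj.
exists (2^-1 ^+ n.+1); first by rewrite exprn_gt0// invr_gt0.
move=> x Nx; apply: WU; rewrite -bn.
have Vx : V n.+1 x.
  apply: (chain_length_lt V0 VS nV); apply: le_lt_trans Nx.
  by rewrite lerDl chain_length_ge0.
have [_] := VSb n x 1%g 1%g Vx (V1 _) (V1 _); rewrite !mulg1 /base.
by case: asboolP => //; rewrite bn.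
Qed.

End length.

(** * A minimax theorem *)

Section minimax.
Context (R : realType) (T : ptopologicalType) (I : choiceType).
Variables (K : set T) (phi : I -> T -> R).
Hypothesis K0 : K !=set0.
Hypothesis cK : compact K.
Hypothesis phic : forall i, continuous (phi i).
Hypothesis convK : forall u v (t : R), K u -> K v -> 0 <= t <= 1 ->
  exists2 w, K w & forall i, phi i w = phi i u + t * (phi i v - phi i u).

Let pos (x : R) := (x + `|x|) / 2.

(** First-order expansion of the square of the positive part, with a one-sided quadratic error; it
    replaces differentiation in the minimax argument. *)
Let pos_sqr (x h : R) : (pos (x + h)) ^+ 2 <= pos x ^+ 2 + 2 * pos x * h + h ^+ 2.
Proof.
rewrite /pos; case: (leP x 0) => x0; case: (leP (x + h) 0) => xh0.
- rewrite (ler0_norm x0) (ler0_norm xh0); nra.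
- rewrite (ler0_norm x0) (gtr0_norm xh0); nra.
- rewrite (gtr0_norm x0) (ler0_norm xh0); nra.
- rewrite (gtr0_norm x0) (gtr0_norm xh0); nra.
Qed.

Let pos_ge0 x : 0 <= pos x.
Proof. by rewrite divr_ge0// -lerBlDl add0r -normrN ler_norm. Qed.

(** By compactness finitely many indices suffice. Minimise over [K] the sum of the squared positive
    parts of [e - phi i u]. The normalised positive parts at a minimiser [u0] are the weights: the
    first-order condition bounds the weighted average at any [v] by that at [u0], which is at most
    [e] since indices of positive weight have [phi i u0 < e]. *)
Lemma affine_minimax (e : R) : (forall u, K u -> exists i, phi i u < e) ->
  exists2 s : seq (R * I), [/\ forall p, p \in s -> 0 <= p.1 & \sum_(p <- s) p.1 = 1] &
    forall u, K u -> \sum_(p <- s) p.1 * phi p.2 u <= e.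
Proof.
move=> Ke.
have [D0 _ KD] : finite_subset_cover [set: I] (fun i => [set u | phi i u < e]) K.
  move: cK; rewrite compact_cover; apply.
    move=> i _; apply: (open_comp _ (@open_lt R e)) => u _; exact: phic.
  by move=> u /Ke[i ie]; exists i.
pose D : seq I := enum_fset D0.
pose d (u : T) := \sum_(i <- D) pos (e - phi i u) ^+ 2.
have dc : continuous d.
  apply: continuous_big => [|i _ u]; first exact: add_continuous.
  apply: (@continuous_comp _ _ _ (fun u => pos (e - phi i u)) (fun x => x ^+ 2)).
    have ce : {for u, continuous (fun u => e - phi i u)}.
      by apply: continuousB; [exact: cst_continuous|exact: phic].
    apply: continuousM; last exact: cst_continuous.
    by apply: continuousD => //; apply: continuous_comp => //; exact: norm_continuous.
  exact: exprn_continuous.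
have [u0 /set_mem Ku0 du0] := compact_EVT_min K0 cK (continuous_subspaceT dc).
(* Up to the factor -2, the weights are the partial derivatives of the sum of
   squares [d] at its minimiser [u0]. *)
pose l i := pos (e - phi i u0).
have l0 i : 0 <= l i by rewrite /l pos_ge0.
pose L := \sum_(i <- D) l i.
have L0 : 0 < L.
  have [i /= iD ie] := KD _ Ku0.
  rewrite /L (big_rem i)//= ltr_wpDr ?sumr_ge0//.
  by rewrite /l /pos gtr0_norm ?subr_gt0// divr_gt0// addr_gt0// subr_gt0.
have first_order v : K v -> \sum_(i <- D) l i * (phi i v - phi i u0) <= 0.
  move=> Kv; set A := \sum_(i <- D) _.
  pose C := \sum_(i <- D) (phi i v - phi i u0) ^+ 2.
  have C0 : 0 <= C by apply: sumr_ge0 => i _; exact: sqr_ge0.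
  have step t : 0 <= t <= 1 -> 2 * t * A <= t ^+ 2 * C.
    move=> t01; have [w Kw wE] := convK Ku0 Kv t01.
    have := du0 w (mem_set Kw).
    have : d w <= d u0 - 2 * t * A + t ^+ 2 * C.
      rewrite /d /A /C !mulr_sumr -sumrB -big_split/=; apply: ler_sum => i _.
      rewrite wE opprD addrA.
      apply: (le_trans (pos_sqr _ _)); rewrite -/(l i); lra.
    lra.
  rewrite leNgt; apply/negP => A0.
  (* Dividing [2 * t * A <= t ^+ 2 * C] by [t] gives [2 * A <= t * C], whereas this [t] satisfies
     [t * C = A - t * A < A]. *)
  pose t := A / (A + C).
  have AC : 0 < A + C by rewrite ltr_wpDr.
  have t0 : 0 < t by rewrite divr_gt0.
  have t1 : t <= 1 by rewrite ler_pdivrMr// mul1r lerDl.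
  have := step t; rewrite (ltW t0) t1 => /(_ isT).
  have tE : t * C = A - t * A by rewrite /t; field; rewrite gt_eqF.
  clearbody t; rewrite expr2 -!mulrA tE mulrCA ler_pM2l//.
  have : 0 < t * A by rewrite mulr_gt0.
  lra.
exists [seq (l i / L, i) | i <- D].
  split; first by move=> _ /mapP[i _ ->]/=; rewrite divr_ge0// ltW.
  by rewrite big_map -mulr_suml divff// gt_eqF.
move=> v Kv; rewrite big_map/=.
under eq_bigr do rewrite mulrAC.
rewrite -mulr_suml ler_pdivrMr//.
have : \sum_(i <- D) l i * phi i v <= \sum_(i <- D) l i * phi i u0.
  by rewrite -subr_le0 -sumrB; under eq_bigr do rewrite -mulrBr; exact: first_order.
move=> /le_trans; apply; rewrite mulr_sumr; apply: ler_sum => i _.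
have [h|h] := leP (e - phi i u0) 0.
  by rewrite /l /pos ler0_norm// addrN !mul0r mulr0.
by rewrite mulrC ler_wpM2r//; lra.
Qed.

End minimax.

(** * Almost invariant finitely supported probabilities *)

(* [compact_cover] is only available on pointed spaces. *)
HB.instance Definition _ (U : Type) (T : U -> ptopologicalType) :=
  isPointed.Build (prod_topology T) (fun=> point).

Section mean.
Context (R : realType) (T : choiceType).
Implicit Types (nu : seq (R * T)) (h : T -> R).

(** A finitely supported measure is a list of weight-point pairs; a point may be repeated, and its
    weights then add up. *)
Definition mean nu h : R := \sum_(p <- nu) p.1 * h p.2.

Definition finite_prob nu :=
  (forall p, p \in nu -> 0 <= p.1) /\ \sum_(p <- nu) p.1 = 1.

Lemma mean_cst nu c : finite_prob nu -> mean nu (fun=> c) = c.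
Proof. by move=> [_ nu1]; rewrite /mean -mulr_suml nu1 mul1r. Qed.

Lemma meanD nu h k : mean nu (fun x => h x + k x) = mean nu h + mean nu k.
Proof. by rewrite /mean -big_split; apply: eq_bigr => p _; rewrite mulrDr. Qed.

Lemma meanN nu h : mean nu (fun x => - h x) = - mean nu h.
Proof. by rewrite /mean -sumrN; apply: eq_bigr => p _; rewrite mulrN. Qed.

Lemma meanB nu h k : mean nu (fun x => h x - k x) = mean nu h - mean nu k.
Proof. by rewrite meanD meanN. Qed.

Lemma le_mean nu h k : finite_prob nu -> (forall p, p \in nu -> h p.2 <= k p.2) ->
  mean nu h <= mean nu k.
Proof.
move=> [nu0 _] hk; rewrite /mean big_seq [leRHS]big_seq; apply: ler_sum => p pnu.
by rewrite ler_wpM2l ?nu0 ?hk.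
Qed.

Lemma norm_mean_le nu h b : finite_prob nu ->
  (forall p, p \in nu -> `|h p.2| <= b) -> `|mean nu h| <= b.
Proof.
move=> fnu hb; rewrite ler_norml -{1}(mean_cst (- b) fnu) -{2}(mean_cst b fnu).
by apply/andP; split; apply: le_mean => // p /hb; rewrite ler_norml => /andP[].
Qed.

End mean.

(** * Right-uniformly continuous functions and Lipschitz balls *)

Section rucb.
Local Open Scope complex_scope.
Context (R : realType) (G : topologicalGroupType).
Implicit Types (f h : G -> R[i]) (u v : G -> R).

Lemma normcR (x : R) : normc x%:C = `|x|.
Proof. by rewrite /= expr0n/= addr0 sqrtr_sqr. Qed.

Lemma normc_ge0 (z : R[i]) : 0 <= normc z.
Proof. by case: z => a b; exact: sqrtr_ge0. Qed.

Lemma normc_le (z : R[i]) : normc z <= `|complex.Re z| + `|complex.Im z|.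
Proof.
case: z => a b /=; rewrite -[leRHS]ger0_norm ?addr_ge0// -sqrtr_sqr ler_wsqrtr//.
by rewrite sqrrD !real_normK ?num_real// addrAC lerDl mulrn_wge0// mulr_ge0.
Qed.

Lemma RUCB_lin (a : R[i]) f h : RUCB f -> RUCB h -> RUCB (fun x => a * f x + h x).
Proof.
move=> [[M fM] uf] [[M' hM] uh]; split.
  exists (normc a * M + M') => x; apply: (le_trans (le_normcD _ _)).
  by rewrite ComplexField.Normc.normcM lerD// ler_wpM2l// normc_ge0.
move=> e e0; pose d := e / 2 / (normc a + 1).
have a1 : 0 < normc a + 1 by rewrite ltr_wpDl// normc_ge0.
have d0 : 0 < d by rewrite !divr_gt0.
have [U nU fU] := uf _ d0; have [W nW hW] := uh _ (divr_gt0 e0 (ltr0Sn _ 1)).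
exists (U `&` W); first exact: filterI.
move=> x y [Ux Wx].
have -> : a * f x + h x - (a * f y + h y) = a * (f x - f y) + (h x - h y) by ring.
apply: (le_trans (le_normcD _ _)); rewrite ComplexField.Normc.normcM.
have : normc a * normc (f x - f y) <= e / 2.
  apply: (@le_trans _ _ ((normc a + 1) * d)).
    by rewrite ler_pM ?normc_ge0 ?fU// lerDl.
  by rewrite /d mulrC divfK// gt_eqF.
by have := hW _ _ Wx; lra.
Qed.

Lemma RUCB_cst (a : R[i]) : RUCB (fun _ : G => a).
Proof.
split; first by exists (normc a).
by move=> e e0; exists setT => [|x y _]; [exact: filterT|rewrite subrr ComplexField.Normc.normc0 ltW].
Qed.

Lemma continuous_ltrans (g : G) : continuous (ltrans g).
Proof.
move=> x; apply: (@continuous_comp _ _ _ (fun x => (g, x)%g)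
  (fun xy : G * G => (xy.1 * xy.2)%g)); last exact: mulg_continuous.
by apply: cvg_pair => /=; [exact: cvg_cst|exact: cvg_id].
Qed.

Lemma nbhs_conjg (g : G) U : nbhs 1%g U -> \forall x \near 1%g, U (g * x * g^-1)%g.
Proof.
move=> nU; have c : continuous (fun x : G => (g * x * g^-1)%g).
  move=> x; apply: (@continuous_comp _ _ _ (fun x => (g * x, g^-1)%g)
    (fun xy : G * G => (xy.1 * xy.2)%g)); last exact: mulg_continuous.
  by apply: cvg_pair => /=; [exact: continuous_ltrans|exact: cvg_cst].
by apply: c; rewrite mulg1 mulgV.
Qed.

(** The element [(g * x) * (g * y)^-1] is the conjugate of [x * y^-1] by [g], so the neighbourhood
    has to be conjugated. *)
Lemma RUCB_ltrans f g : RUCB f -> RUCB (f \o ltrans g).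
Proof.
move=> [[M fM] uf]; split; first by exists M => x; exact: fM.
move=> e e0; have [U nU fU] := uf _ e0.
exists [set x | U (g * x * g^-1)%g]; first exact: nbhs_conjg.
move=> x y /= Uxy; apply: fU.
by rewrite /ltrans invgM !mulgA in Uxy *.
Qed.

Variable N : G -> R.
Hypothesis lN : length_function N.

(** The pseudometric [N (x * y^-1)] is right-invariant: right translations preserve the ball,
    whereas left translations may not. *)
Definition lipschitz_ball (c : R) : set (G -> R) := [set u |
  (forall x, `|u x| <= c) /\ (forall x y, `|u x - u y| <= c * N (x * y^-1)%g)].

Lemma lipschitz_ball_RUCB c u : 0 <= c -> lipschitz_ball c u -> RUCB (fun x => (u x)%:C).
Proof.
move=> c0 [uc uL]; split; first by exists c => x; rewrite normcR.
move=> e e0; exists [set x | N x < e / (c + 1)].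
  by apply: length_cvg1 => //; rewrite divr_gt0// ltr_wpDl.
move=> x y Nxy; rewrite -rmorphB normcR (le_trans (uL x y))//.
apply: (@le_trans _ _ ((c + 1) * (e / (c + 1)))).
  by rewrite ler_pM// ?(length_ge0 lN)// ?lerDl// ltW.
by rewrite mulrC divfK// gt_eqF// ltr_wpDl.
Qed.

Lemma lipschitz_ball_rtrans c u y : lipschitz_ball c u ->
  lipschitz_ball c (fun x => u (x * y)%g).
Proof.
move=> [uc uL]; split => [x|x z]; first exact: uc.
by rewrite (le_trans (uL _ _))// invgM mulgA mulgK.
Qed.

Lemma lipschitz_ballN c u : lipschitz_ball c u -> lipschitz_ball c (fun x => - u x).
Proof.
move=> [uc uL]; split => [x|x y]; first by rewrite normrN.
by rewrite -opprD normrN.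
Qed.

Lemma lipschitz_ball_le c d : c <= d -> lipschitz_ball c `<=` lipschitz_ball d.
Proof.
move=> cd u [uc uL]; split => [x|x y]; first exact: le_trans cd.
by rewrite (le_trans (uL x y))// ler_wpM2r// (length_ge0 lN).
Qed.

Lemma ler_norm_segment (c a b t : R) : `|a| <= c -> `|b| <= c -> 0 <= t <= 1 ->
  `|a + t * (b - a)| <= c.
Proof.
rewrite !ler_norml => /andP[? ?] /andP[? ?] /andP[? ?]; apply/andP; split; nra.
Qed.

Let P := {ptws (G * G)%type -> R}.

(* [F (g, _)] is the function tested against the translation by [g]. *)
Let K (c : R) : set P := [set F : P | (forall p, `|F p| <= c) /\
  (forall g x y, `|F (g, x) - F (g, y)| <= c * N (x * y^-1)%g)].

Let eval_continuous p : continuous (fun F : P => F p).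
Proof. exact: (@proj_continuous (G * G)%type (fun=> R : topologicalType) p). Qed.

Let compactK c : compact (K c).
Proof.
apply: (@subclosed_compact _ _ [set F : P | forall p, `[- c, c]%classic (F p)]).
- have -> : K c = [set F | forall p, `|F p| <= c] `&`
      [set F | forall q : G * (G * G), `|F (q.1, q.2.1) - F (q.1, q.2.2)| <= c * N (q.2.1 * q.2.2^-1)%g].
    apply/seteqP; split => F [F1 F2]; split=> //.
    by move=> g x y; exact: (F2 (g, (x, y))).
  have cl (J : Type) (k : J -> P -> R) (r : J -> R) : (forall i, continuous (k i)) ->
      closed [set F | forall i, `|k i F| <= r i].
    move=> kc; rewrite (_ : [set _ | _] = \bigcap_i ((fun F => `|k i F|) @^-1` [set x | x <= r i])).
      apply: closed_bigI => i _; apply: preimage_closed; last exact: closed_le.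
      by move=> F _; apply: continuous_comp; [exact: kc|exact: norm_continuous].
    by apply/seteqP; split => F FK i; [move=> _; exact: FK|exact: (FK i I)].
  apply: closedI; apply: cl => p F; first exact: eval_continuous.
  by apply: continuousB; exact: eval_continuous.
- apply: (@tychonoff _ (fun=> R : topologicalType) (fun=> `[- c, c]%classic)) => p.
  exact: segment_compact.
- by move=> F [F1 _] p; rewrite /= in_itv/= -ler_norml.
Qed.

(** For a fixed [F] in [K c] the invariant state sends [phi _ F] to 0, so [phi _ F] cannot be at
    least [e] everywhere. The minimax theorem turns this into one [nu] that is good for all [F],
    hence for the whole Lipschitz ball and all of [E] at once. *)
Lemma amenable_almost_invariant (E : seq G) (c e : R) :
  amenable R G -> 0 <= c -> 0 < e -> exists2 nu, finite_prob nu &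
    forall g u, g \in E -> lipschitz_ball c u ->
      `|mean nu (u \o ltrans g) - mean nu u| <= e.
Proof.
move=> [mu muinv] c0 e0.
pose phi (x : G) (F : P) : R := \sum_(g <- undup E) (F (g, g * x)%g - F (g, x)).
have phic x : continuous (phi x).
  apply: continuous_big => [|g _ F]; first exact: add_continuous.
  by apply: continuousB; exact: eval_continuous.
have K0 : K c !=set0.
  exists ((fun=> 0) : P); split => [p|g x y]; first by rewrite normr0.
  by rewrite subrr normr0 mulr_ge0// (length_ge0 lN).
have convK (u v : P) (t : R) : K c u -> K c v -> 0 <= t <= 1 ->
    exists2 w, K c w & forall x, phi x w = phi x u + t * (phi x v - phi x u).
  move=> [u1 u2] [v1 v2] t01; exists ((fun p => u p + t * (v p - u p)) : P).
    split => [p|g x y]; first exact: ler_norm_segment.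
    have := ler_norm_segment (u2 g x y) (v2 g x y) t01.
    by rewrite (_ : _ + _ = u (g, x) + t * (v (g, x) - u (g, x)) - (u (g, y) + t * (v (g, y) - u (g, y))))//; ring.
  move=> x; rewrite /phi -sumrB mulr_sumr -big_split/=; apply: eq_bigr => g _; ring.
have mu0 : mu (fun=> 0) = 0.
  have := stateP mu (-1) (RUCB_cst 0) (RUCB_cst 0).
  rewrite (_ : (fun x => _) = (fun=> 0)); last by apply/funext => x; rewrite mulr0 addr0.
  by rewrite mulN1r addNr.
have neg (F : P) : K c F -> exists x, phi x F < e.
  move=> [F1 F2]; apply: contrapT => /forallNP nF.
  have FR g : RUCB (fun x => (F (g, x))%:C).
    by apply: (lipschitz_ball_RUCB c0); split => [x|x y]; [exact: F1|exact: F2].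
  have [H1 H2] : RUCB (fun x => (phi x F)%:C) /\ mu (fun x => (phi x F)%:C) = 0.
    rewrite /phi; elim: (undup E) => [|g s [IH1 IH2]].
      under eq_fun do rewrite big_nil.
      by split; [exact: RUCB_cst|exact: mu0].
    under eq_fun do rewrite big_cons.
    have dE : (fun x => (F (g, g * x)%g - F (g, x))%:C) =
        (fun x => -1 * (F (g, x))%:C + ((fun x => (F (g, x))%:C) \o ltrans g) x).
      by apply/funext => x; rewrite rmorphB addrC mulN1r.
    have Rd : RUCB (fun x => (F (g, g * x)%g - F (g, x))%:C).
      by rewrite dE; apply: RUCB_lin => //; exact: RUCB_ltrans.
    have mud : mu (fun x => (F (g, g * x)%g - F (g, x))%:C) = 0.
      by rewrite dE stateP ?muinv ?mulN1r ?addNr//; exact: RUCB_ltrans.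
    have -> : (fun x => (F (g, g * x)%g - F (g, x) + \sum_(j <- s) (F (j, j * x)%g - F (j, x)))%:C) =
        (fun x => 1 * (F (g, g * x)%g - F (g, x))%:C + (\sum_(j <- s) (F (j, j * x)%g - F (j, x)))%:C).
      by apply/funext => x; rewrite rmorphD mul1r.
    split; first exact: RUCB_lin.
    by rewrite stateP// mud IH2 mulr0 addr0.
  have mue : mu (fun=> (- e)%:C) = (- e)%:C.
    have := stateP mu (- e)%:C (RUCB_cst 1) (RUCB_cst 0).
    rewrite (_ : (fun x => _) = (fun=> (- e)%:C)); last by apply/funext => x; rewrite mulr1 addr0.
    by rewrite state1 mu0 mulr1 addr0.
  have := @state_ge0 _ _ mu (fun x => 1 * (phi x F)%:C + (- e)%:C) (RUCB_lin _ H1 (RUCB_cst _)).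
  rewrite stateP// ?H2; last exact: RUCB_cst.
  rewrite mulr0 add0r mue => /(_ _).
  have H x : 0 <= 1 * (phi x F)%:C + (- e)%:C.
    by rewrite mul1r -rmorphD ler0c subr_ge0 leNgt; apply/negP; exact: nF.
  by move=> /(_ H); rewrite ler0c oppr_ge0 leNgt e0.
have [nu [nu0 nu1] nuP] := affine_minimax K0 (compactK (c := c)) phic convK neg.
exists nu; first by split.
have main g u : g \in E -> lipschitz_ball c u -> mean nu (u \o ltrans g) - mean nu u <= e.
  move=> gE [uc uL].
  (* Only the slice of [g] is nonzero and [undup] counts it once, so [phi] reduces to the single
     term for the translation by [g]. *)
  pose F : P := fun p => if p.1 == g then u p.2 else 0.
  have KF : K c F.
    split => [p|g' x y]; rewrite /F/=; first by case: ifP => // _; rewrite normr0.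
    by case: ifP => // _; rewrite subrr normr0 mulr_ge0// (length_ge0 lN).
  apply: le_trans (nuP _ KF).
  rewrite /mean -sumrB le_eqVlt; apply/orP; left; apply/eqP; apply: eq_bigr => p _.
  rewrite /phi (bigD1_seq g)/= ?mem_undup ?undup_uniq// big1 => [|h /negbTE hg].
    by rewrite /F/= eqxx addr0 mulrBr.
  by rewrite /F/= hg subrr.
move=> g u gE uc; rewrite ler_norml main// andbT lerNl.
by have := main _ _ gE (lipschitz_ballN uc); rewrite !meanN; lra.
Qed.

End rucb.

(** * Countable mixtures of finitely supported probabilities *)

Lemma probability_bounded_integrable d (T : measurableType d) (R : realType)
    (P : probability T R) (h : T -> R) c : measurable_fun setT h ->
  (forall x, `|h x| <= c) -> P.-integrable setT (EFin \o h).
Proof.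
move=> mh hc; apply: measurable_bounded_integrable => //.
  by rewrite (le_lt_trans (probability_le1 P _))// ltry.
by exists c; split; [exact: num_real|move=> M cM x _ /=; rewrite (le_trans (hc x))// ltW].
Qed.

Section atomic.
Context d (T : measurableType d) (R : realType).
Local Notation half := (2^-1 : R).

(** The absolute value makes this a measure for every list; for a [finite_prob] list it changes
    nothing. The index stays below the size, so the default of [nth] is never read. *)
Definition finite_atomic (nu : seq (R * T)) : {measure set T -> \bar R} :=
  msum (fun j => mscale (`|(nth (0, point) nu j).1|%:nng) \d_((nth (0, point) nu j).2))
    (size nu).

Let nng_norm (nu : seq (R * T)) j : finite_prob nu -> (j < size nu)%N ->
  (`|(nth (0, point) nu j).1|%:nng%:num : R) = (nth (0, point) nu j).1.
Proof. by move=> [nu0 _] js /=; rewrite ger0_norm// nu0// mem_nth. Qed.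

Lemma finite_atomicE nu (A : set T) : finite_prob nu ->
  finite_atomic nu A = (mean nu \1_A)%:E.
Proof.
move=> fnu; rewrite /finite_atomic/= /msum /mean (big_nth (0, point)) big_mkord -sumEFin.
apply: eq_bigr => j _; set p := nth _ _ _.
rewrite [LHS](_ : _ = (`|p.1|%:E * \d_(p.2) A)%E)// /dirac -EFinM ger0_norm//.
by apply: fnu.1; rewrite mem_nth.
Qed.

Lemma integral_finite_atomic nu (h : T -> R) : finite_prob nu ->
  measurable_fun setT h -> (forall x, 0 <= h x) ->
  (\int[finite_atomic nu]_x (h x)%:E = (mean nu h)%:E)%E.
Proof.
move=> fnu mh h0.
have mh' : measurable_fun setT (EFin \o h) by exact/measurable_EFinP.
rewrite ge0_integral_measure_sum//; last by move=> x _; rewrite lee_fin.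
rewrite /mean (big_nth (0, point)) big_mkord -sumEFin.
apply: eq_bigr => j _; rewrite ge0_integral_mscale//; last by move=> x _; rewrite lee_fin.
by rewrite integral_dirac// diracT mul1e nng_norm//.
Qed.

Lemma sum_half n : \sum_(i < n) half ^+ i.+1 = 1 - half ^+ n.
Proof.
elim: n => [|n IH]; first by rewrite big_ord0 expr0 subrr.
by rewrite big_ord_recr/= IH exprS; lra.
Qed.

Lemma half_gt0 n : 0 < half ^+ n. Proof. by rewrite exprn_gt0// invr_gt0. Qed.

Variable nu : nat -> seq (R * T).
Hypothesis fnu : forall i, finite_prob (nu i).

Let mu_ (i : nat) : {measure set T -> \bar R} :=
  mscale (NngNum (ltW (half_gt0 i.+1))) (finite_atomic (nu i)).

Let mu : {measure set T -> \bar R} := mseries mu_ 0.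

Let muE A : mu A = (\sum_(0 <= i <oo) (half ^+ i.+1 * mean (nu i) \1_A)%:E)%E.
Proof.
by apply: eq_eseriesr => i _; rewrite /mu_/= /mscale/= finite_atomicE.
Qed.

Let muT : mu setT = 1%E.
Proof.
rewrite muE; apply/cvg_lim => //.
rewrite (_ : (fun n => _) = (fun n => (1 - half ^+ n)%:E)).
  apply: cvg_EFin; first by near=> n.
  rewrite -[X in _ --> X]subr0; by apply: cvgB; [exact: cvg_cst|exact: cvg_half].
apply/funext => n; rewrite big_mkord sumEFin -sum_half; congr EFin.
apply: eq_bigr => i _; rewrite (_ : \1_setT = fun=> 1) ?mean_cst ?mulr1//.
by apply/funext => x; rewrite indicT.
Unshelve. all: by end_near. Qed.

Let P : probability T R := HB.pack (Measure.sort mu)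
  (Measure_isProbability.Build _ _ _ (Measure.sort mu) muT).

(** The indices below [m] have total mass 1 - 2^-m and the others 2^-m. Adding [c] makes the
    integrand nonnegative, so that its integral against the series measure is the series of the
    integrals. *)
Let integral_le (h : T -> R) c m b e : measurable_fun setT h ->
  (forall x, `|h x| <= c) ->
  (forall i, (i < m)%N -> mean (nu i) h <= b) ->
  (forall i, (m <= i)%N -> mean (nu i) h <= e) ->
  \int[mu]_x h x <= (1 - half ^+ m) * b + half ^+ m * e.
Proof.
move=> mh hc hb he.
have ih : mu.-integrable setT (EFin \o h) := probability_bounded_integrable P mh hc.
have ic : mu.-integrable setT (EFin \o (fun=> c)).
  exact: (@probability_bounded_integrable _ _ _ P _ `|c|).
(* The tail up to [n] has mass 2^-m - 2^-n; this sign allows enlarging it to 2^-m. *)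
have ec : 0 <= e + c.
  have : - c <= mean (nu m) h.
    rewrite -(mean_cst (- c) (fnu m)); apply: le_mean => // p _.
    by move: (hc p.2); rewrite ler_norml => /andP[].
  by have := he m (leqnn m); lra.
suff : \int[mu]_x (h x + c) <= (1 - half ^+ m) * b + half ^+ m * e + c.
  rewrite RintegralD// Rintegral_cst// -[X in fine X]/(mu setT) muT/=; lra.
have hc0 x : 0 <= h x + c by move: (hc x); rewrite ler_norml => /andP[]; lra.
have mhc : measurable_fun setT (fun x => h x + c) by apply: measurable_funD.
have fin : (\int[mu]_x (h x + c)%:E \is a fin_num)%E.
  apply: integrable_fin_num => //.
  rewrite (_ : (fun x => _) = (fun x => (h x)%:E + c%:E)%E)//; exact: integrableD.
rewrite -lee_fin /Rintegral fineK//.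
rewrite ge0_integral_measure_series; [|by []|by move=> x _; rewrite lee_fin|exact/measurable_EFinP].
apply: lime_le.
  apply: is_cvg_nneseries => n _ _; apply: integral_ge0 => x _.
  by rewrite lee_fin.
near=> n.
have mn : (m <= n)%N by near: n; exists m.
rewrite big_mkord.
have tE (i : nat) : (\int[mu_ i]_x (h x + c)%:E)%E = (half ^+ i.+1 * (mean (nu i) h + c))%:E.
  rewrite ge0_integral_mscale; [|by []|exact/measurable_EFinP|by move=> x _; rewrite lee_fin].
  by rewrite integral_finite_atomic// -EFinM meanD mean_cst.
under eq_bigr do rewrite tE.
rewrite sumEFin lee_fin -(big_mkord xpredT (fun i => half ^+ i.+1 * (mean (nu i) h + c))).
rewrite (big_cat_nat _ mn)//=.
have H1 : \sum_(0 <= i < m) half ^+ i.+1 * (mean (nu i) h + c) <= (1 - half ^+ m) * (b + c).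
  rewrite -sum_half mulr_suml big_mkord; apply: ler_sum => i _.
  by rewrite ler_pM2l ?half_gt0// lerD2r hb.
have H2 : \sum_(m <= i < n) half ^+ i.+1 * (mean (nu i) h + c) <= (half ^+ m - half ^+ n) * (e + c).
  have -> : half ^+ m - half ^+ n = \sum_(m <= i < n) half ^+ i.+1.
    apply: (@addrI _ (\sum_(0 <= i < m) half ^+ i.+1)).
    rewrite -(big_cat_nat _ mn)//= !big_mkord !sum_half; lra.
  rewrite mulr_suml; apply: ler_sum_nat => i /andP[mi _].
  by rewrite ler_pM2l ?half_gt0// lerD2r he.
have : 0 <= half ^+ n * (e + c) by rewrite mulr_ge0// ltW// half_gt0.
move: H1 H2; lra.
Unshelve. all: by end_near. Qed.

Lemma atomic_probability : exists P : probability T R,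
  (forall A, P A = \sum_(0 <= i <oo) (half ^+ i.+1 * mean (nu i) \1_A)%:E)%E /\
  forall (h : T -> R) c m b e, measurable_fun setT h ->
    (forall x, `|h x| <= c) ->
    (forall i, (i < m)%N -> `|mean (nu i) h| <= b) ->
    (forall i, (m <= i)%N -> `|mean (nu i) h| <= e) ->
    `|\int[P]_x h x| <= (1 - half ^+ m) * b + half ^+ m * e.
Proof.
exists P; split; first exact: muE.
move=> h c m b e mh hc hb he; rewrite ler_norml.
have ih : mu.-integrable setT (EFin \o h) := probability_bounded_integrable P mh hc.
apply/andP; split; last first.
  by apply: (integral_le mh hc) => i im; rewrite (le_trans (ler_norm _))// (hb, he).
have := @integral_le (fun x => - h x) c m b e.
rewrite (_ : \int[mu]_x (- h x) = - \int[mu]_x h x); last first.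
  by rewrite -mulN1r -RintegralZl//; apply: eq_Rintegral => x _; rewrite mulN1r.
rewrite lerNl; apply.
- exact: measurableT_comp.
- by move=> x; rewrite normrN.
- by move=> i im; rewrite meanN (le_trans (ler_norm _))// normrN hb.
- by move=> i im; rewrite meanN (le_trans (ler_norm _))// normrN he.
Qed.

End atomic.

(** * Convolution powers *)

Section prob.
Context d (T : measurableType d) (R : realType) (P : probability T R).

Lemma probability_Rintegral_cst (c : R) : \int[P]_x c = c.
Proof.
have PT : P setT = 1%E := probability_setT P.
by rewrite Rintegral_cst// -[X in fine X]/(P setT) PT/= mulr1.
Qed.

Lemma norm_probability_integral_le (h : T -> R) c : measurable_fun setT h ->
  (forall x, `|h x| <= c) -> `|\int[P]_x h x| <= c.
Proof.
move=> mh hc; have ih := probability_bounded_integrable P mh hc.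
apply: (le_trans (le_normr_Rintegral measurableT ih)).
rewrite -[leRHS]probability_Rintegral_cst; apply: le_Rintegral => //.
  apply: (@probability_bounded_integrable _ _ _ P _ c); first exact: measurableT_comp.
  by move=> x; rewrite normr_id.
by apply: (@probability_bounded_integrable _ _ _ P _ `|c|).
Qed.

Lemma Rintegral_mean (X : choiceType) (nu : seq (R * X)) (h : X -> T -> R) c :
  (forall x, measurable_fun setT (h x)) -> (forall x y, `|h x y| <= c) ->
  \int[P]_y mean nu (h ^~ y) = mean nu (fun x => \int[P]_y h x y).
Proof.
move=> mh hc; have ih x := probability_bounded_integrable P (mh x) (hc x).
have iM a x : P.-integrable setT (EFin \o (fun y => a * h x y)).
  apply: (@probability_bounded_integrable _ _ _ P _ (`|a| * c)).
    by apply: measurable_funM.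
  by move=> y; rewrite normrM ler_wpM2l.
rewrite /mean; elim: nu => [|p nu IH].
  rewrite big_nil; under eq_Rintegral do rewrite big_nil.
  exact: probability_Rintegral_cst.
rewrite big_cons -IH; under eq_Rintegral do rewrite big_cons.
rewrite RintegralD//; first by rewrite RintegralZl.
rewrite (_ : _ \o _ = (fun y => \sum_(q <- nu) (q.1 * h q.2 y)%:E)%E).
  by apply: integrable_sum => // q _; exact: iM.
by apply/funext => y; rewrite sumEFin.
Qed.

End prob.

Section convolution_power.
Context (R : realType) (G : topologicalGroupType).
Hypothesis scG : @second_countable G.
Implicit Types (mu nu : probability (borel G) R).

Lemma Rintegral_convolution mu nu (f : G -> R) c : continuous f ->
  (forall x, `|f x| <= c) ->
  measurable_fun setT ((fun x => \int[nu]_y f (x * y)%g) : borel G -> R) /\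
  \int[convolution scG mu nu]_z f z = \int[mu]_x \int[nu]_y f (x * y)%g.
Proof.
move=> cf fc.
have mf : measurable_fun setT (f : borel G -> R) by exact: continuous_borel_measurable.
pose F := fun xy : borel G * borel G => (f (mulg_pair xy))%:E.
have mF : measurable_fun setT (fun xy : borel G * borel G => f (mulg_pair xy)).
  by apply: measurableT_comp => //; exact: measurable_mulg_pair.
have iF : (mu \x nu)%E.-integrable setT F.
  exact: (@probability_bounded_integrable _ _ _ (mu \x nu)%E _ c).
have mI := measurable_fubini_F iF.
split; first by apply: measurableT_comp mI; exact: fine_measurable.
rewrite /Rintegral integral_distribution//; last exact/measurable_EFinP.
rewrite -integral12_prod_meas1//; congr fine; apply: eq_integral => x _.
rewrite fineK//; apply: integrable_fin_num => //.
apply: (@probability_bounded_integrable _ _ _ nu _ c) => //.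
by apply: continuous_borel_measurable => y; apply: continuous_comp; [exact: continuous_ltrans|exact: cf].
Qed.

Section decay.
Variables (mu : probability (borel G) R) (nu : nat -> seq (R * G)) (m : nat).
Hypothesis fnu : forall i, finite_prob (nu i).
Hypothesis muP : forall (h : borel G -> R) c b e, measurable_fun setT h ->
  (forall x, `|h x| <= c) ->
  (forall i, (i < m)%N -> `|mean (nu i) h| <= b) ->
  (forall i, (m <= i)%N -> `|mean (nu i) h| <= e) ->
  `|\int[mu]_x h x| <= (1 - 2^-1 ^+ m) * b + 2^-1 ^+ m * e.

Let L n (f : G -> R) := \int[convolution_power scG mu n]_x f x.

(** Condition on the first factor [x]. If it is drawn from [nu i] with [i < m], each atom is bounded
    separately by [b]; if [m <= i], Fubini averages over [x] first, with the product [y] of the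
    remaining factors fixed, which gives [e]. *)
Lemma norm_convolution_powerS_le n (f : G -> R) c b e : continuous f ->
  (forall x, `|f x| <= c) ->
  (forall i p, (i < m)%N -> p \in nu i -> `|L n (f \o ltrans p.2)| <= b) ->
  (forall i y, (m <= i)%N -> `|mean (nu i) (fun x => f (x * y)%g)| <= e) ->
  `|L n.+1 f| <= (1 - 2^-1 ^+ m) * b + 2^-1 ^+ m * e.
Proof.
move=> cf fc fb fe.
have cfl x : continuous (f \o ltrans x).
  by move=> y; apply: continuous_comp; [exact: continuous_ltrans|exact: cf].
have mfl x : measurable_fun setT ((f \o ltrans x) : borel G -> R).
  exact: continuous_borel_measurable.
have [mI fE] := Rintegral_convolution mu (convolution_power scG mu n) cf fc.
rewrite -[L n.+1 f]/(\int[convolution scG mu (convolution_power scG mu n)]_z f z) fE.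
apply: (muP (c := c) mI) => [x|i im|i mi].
- apply: norm_probability_integral_le => [|y]; [exact: mfl|exact: fc].
- by apply: norm_mean_le => // p pnu; exact: fb pnu.
- have <- := Rintegral_mean (convolution_power scG mu n) (nu i) mfl (fun x y => fc (x * y)%g).
  apply: norm_probability_integral_le => [|y]; last exact: fe.
  by apply: measurable_sum => p; apply: measurable_funM => //; exact: mfl.
Qed.

Variables (W : nat -> set G) (J : nat) (u : G -> R) (c e : R).
Hypothesis WS : forall j w i p, (i < m)%N -> p \in nu i -> W j w -> W j.+1 (w * p.2)%g.
Hypothesis cu : continuous u.
Hypothesis uc : forall x, `|u x| <= c.
Hypothesis ue : forall i j w y, (m <= i)%N -> (j <= J)%N -> W j w ->
  `|mean (nu i) (fun x => u (w * x * y)%g) - mean (nu i) (fun x => u (x * y)%g)| <= e.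

(* The first factor taken from [nu i] with [m <= i] absorbs the words produced
   by the previous factors, and no such factor occurs among the first [k] with
   probability [(1 - 2^-m) ^+ k]. *)
Lemma convolution_power_decay k n j w w' : (k <= n)%N -> (j + k <= J)%N ->
  W j w -> W j w' ->
  `|L n (fun x => u (w * x)%g - u (w' * x)%g)| <=
    2 * c * (1 - 2^-1 ^+ m) ^+ k + 2 * e.
Proof.
have c0 : 0 <= c by apply: le_trans (uc 1%g).
have cul x : continuous (u \o ltrans x).
  by move=> y; apply: continuous_comp; [exact: continuous_ltrans|exact: cu].
have cuw (v v' : G) : continuous (fun x => u (v * x)%g - u (v' * x)%g).
  by move=> y; apply: continuousB; exact: cul.
have ucw (v v' : G) x : `|u (v * x)%g - u (v' * x)%g| <= 2 * c.
  rewrite (le_trans (ler_normB _ _))//; have := uc (v * x)%g; have := uc (v' * x)%g; lra.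
elim: k n j w w' => [|k IH] n j w w'.
  rewrite addn0 expr0 mulr1 => _ jJ Wj Wj'.
  have e0 : 0 <= e by apply: le_trans (ue 1%g (leqnn m) jJ Wj).
  rewrite (@le_trans _ _ (2 * c))//; last by rewrite lerDl mulr_ge0.
  apply: norm_probability_integral_le => //.
  exact: continuous_borel_measurable.
case: n => // n; rewrite ltnS => kn jkJ Wj Wj'.
have jJ : (j <= J)%N by rewrite (leq_trans _ jkJ)// leq_addr.
(* The bound solves the recursion produced by splitting off the first factor: one from [nu i] with
   [i < m] extends both words and leaves the bound for [k], any other costs [2 * e]. *)
have -> : 2 * c * (1 - 2^-1 ^+ m) ^+ k.+1 + 2 * e =
    (1 - 2^-1 ^+ m) * (2 * c * (1 - 2^-1 ^+ m) ^+ k + 2 * e) + 2^-1 ^+ m * (2 * e).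
  by rewrite exprS; ring.
apply: (norm_convolution_powerS_le (c := 2 * c)) => //.
- move=> i p im pnu; rewrite /ltrans.
  rewrite (_ : _ \o _ = (fun x => u (w * p.2 * x)%g - u (w' * p.2 * x)%g)).
    by apply: (IH n j.+1) => //; [rewrite addSnnS|exact: WS pnu Wj|exact: WS pnu Wj'].
  by apply/funext => x /=; rewrite !mulgA.
- move=> i y mi.
  rewrite (_ : (fun x => _) = (fun x => u (w * x * y)%g - u (w' * x * y)%g)); last first.
    by apply/funext => x; rewrite !mulgA.
  (* Both words are compared with the empty word, hence twice [e]. *)
  rewrite meanB; have := ue y mi jJ Wj; have := ue y mi jJ Wj'.
  set A := mean _ _; set B := mean _ _; set C := mean _ _ => H1 H2.
  rewrite (_ : C - A = (C - B) - (A - B)); last by ring.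
  rewrite (le_trans (ler_normB _ _))//; lra.
Qed.

End decay.
End convolution_power.

(** * The step distributions *)

Lemma second_countable_dense_sequence (T : ptopologicalType) :
  @second_countable T -> exists g : nat -> T, forall (x : T) (U : set T), nbhs x U -> exists n, U (g n).
Proof.
move=> [B cB [Bo Bb]]; have /pfcard_geP[B0|[b]] := cB.
  by exists (fun=> point) => x U /Bb[W []]; rewrite B0.
have /choice[g gP] : forall n, exists x, b n !=set0 -> b n x.
  by move=> n; have [[x bx]|nb] := pselect (b n !=set0); [exists x|exists point].
exists g => x U /Bb[W [BW Wx] WU].
have [n _ bn] : (range b) W by exact: surj.
by exists n; apply: WU; rewrite -bn; apply: gP; exists x; rewrite bn.
Qed.

(** Bernoulli-type estimate, by induction from (1 - a)(1 + (n + 1)a) = 1 + na - (n + 1)a^2. *)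
Lemma expr_1B_le (R : realFieldType) (a : R) n : 0 <= a <= 1 ->
  (1 - a) ^+ n * (1 + n%:R * a) <= 1.
Proof.
move=> /andP[a0 a1]; elim: n => [|n IH]; first by rewrite expr0 mul0r addr0 mulr1.
apply: le_trans IH; rewrite exprSr -mulrA ler_wpM2l ?exprn_ge0 ?subr_ge0//.
rewrite -natr1; have : 0 <= (n%:R + 1) * a ^+ 2 by rewrite mulr_ge0 ?sqr_ge0// addr_ge0.
by move=> h; rewrite -subr_ge0; apply: le_trans h _; rewrite le_eqVlt; apply/orP; left; apply/eqP; ring.
Qed.

Section words.
Context (G : groupType).

(** An element of [1 :: E] followed by at most [n] letters from [S]. In the walk, [E] holds the
    translations under test and [S] the atoms of earlier step distributions. *)
Fixpoint words (S E : seq G) (n : nat) : seq G :=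
  if n is n'.+1 then words S E n' ++ [seq (w * x)%g | w <- words S E n', x <- S]
  else 1%g :: E.

Lemma words_sub S S' E E' n n' : {subset S <= S'} -> {subset E <= E'} ->
  (n <= n')%N -> {subset words S E n <= words S' E' n'}.
Proof.
move=> SS EE nn w wn; have {wn} : w \in words S' E' n.
  elim: n {nn} w wn => [|n IH] w /=.
    by rewrite !inE => /predU1P[->|/EE ->]; rewrite ?eqxx ?orbT.
  rewrite !mem_cat => /orP[/IH ->//|/allpairsP[[v x]/= [vn xS ->]]].
  apply/orP; right; apply/allpairsP; exists (v, x); split => //=.
    exact: IH.
  exact: SS.
move: nn => /subnK <-; elim: (n' - n)%N => // k IH wn.
by rewrite addSn /= mem_cat IH.
Qed.

End words.

Section construction.
Context (R : realType) (G : topologicalGroupType) (N : G -> R).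
Hypothesis lN : length_function N.
Local Notation half := (2^-1 : R).

(** Mixing in a small mass at [g], which serves full support, costs at most [2 * c] times that mass
    in almost invariance. *)
Lemma amenable_almost_invariant_atom (E : seq G) (c e : R) (g : G) :
  amenable R G -> 0 <= c -> 0 < e <= 1 -> exists nu, [/\ finite_prob nu,
    (exists2 a, 0 < a & (a, g) \in nu) &
    forall w u, w \in E -> lipschitz_ball N c u ->
      `|mean nu (u \o ltrans w) - mean nu u| <= e].
Proof.
move=> am c0 /andP[e0 e1].
have [nu [nu0 nu1] nuP] := amenable_almost_invariant lN E am c0 (divr_gt0 e0 (ltr0Sn _ 1)).
(* With this [a] the atom contributes at most [a * (2 * c) <= e / 2]; the other [e / 2] comes from
   [nu]. The [c + 1] keeps the denominator positive, and [e <= 1] gives [a <= 1]. *)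
pose a := e / (4 * (c + 1)).
have c1 : 0 < 4 * (c + 1) by lra.
have a0 : 0 < a by rewrite divr_gt0.
have aE : a * (4 * (c + 1)) = e by rewrite /a divfK// gt_eqF.
clearbody a.
have ac : 0 <= a * c by rewrite mulr_ge0// ltW.
have a1 : a <= 1 by lra.
pose nu' := (a, g) :: [seq ((1 - a) * p.1, p.2) | p <- nu].
have mE (h : G -> R) : mean nu' h = a * h g + (1 - a) * mean nu h.
  rewrite /mean big_cons big_map mulr_sumr; congr (_ + _).
  by apply: eq_bigr => p _; rewrite mulrA.
exists nu'; split.
- split.
    move=> p; rewrite inE => /predU1P[->|/mapP[q qnu ->]]; first exact: ltW.
    by rewrite mulr_ge0 ?nu0// subr_ge0.
  by rewrite big_cons big_map /= -mulr_sumr nu1 mulr1 addrC subrK.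
- by exists a => //; rewrite inE eqxx.
- move=> w u wE uc; rewrite !mE.
  have -> : a * (u \o ltrans w) g + (1 - a) * mean nu (u \o ltrans w) - (a * u g + (1 - a) * mean nu u) =
    a * (u (w * g)%g - u g) + (1 - a) * (mean nu (u \o ltrans w) - mean nu u).
    rewrite /=/ltrans; ring.
  rewrite (le_trans (ler_normD _ _))// !normrM (gtr0_norm a0) (ger0_norm (_ : 0 <= 1 - a)) ?subr_ge0//.
  have h1 : a * `|u (w * g)%g - u g| <= a * (2 * c).
    rewrite ler_pM2l// (le_trans (ler_normB _ _))//.
    by have := uc.1 (w * g)%g; have := uc.1 g; lra.
  have h2 : (1 - a) * `|mean nu (u \o ltrans w) - mean nu u| <= e / 2.
    have := nuP _ _ wE uc; set A := `|mean _ _ - _| => hA.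
    have : 0 <= a * A by apply: mulr_ge0; [exact: ltW|exact: normr_ge0].
    lra.
  lra.
Qed.

(** The list [S m] collects the atoms of all [nu j] with [j < m], and [nu m] is chosen once [S m] is
    known. Almost invariance is arranged for [m = i] and passes to smaller [m] because the sets of
    words grow with the index. *)
Lemma exists_almost_invariant_sequence (g : nat -> G) : amenable R G ->
  exists (nu : nat -> seq (R * G)) (S : nat -> seq G),
  [/\ forall i, finite_prob (nu i),
      forall i, exists2 a, 0 < a & (a, g i) \in nu i,
      forall m i p, (i < m)%N -> p \in nu i -> p.2 \in S m &
      forall m i w u, (m <= i)%N -> w \in words (S m) (mkseq g m.+1) (4 ^ m) ->
        lipschitz_ball N i%:R u ->
        `|mean (nu i) (u \o ltrans w) - mean (nu i) u| <= half ^+ i].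
Proof.
move=> am.
have /choice[pick pickP] : forall iS : nat * seq G, exists nu, [/\ finite_prob nu,
    (exists2 a, 0 < a & (a, g iS.1) \in nu) &
    forall w u, w \in words iS.2 (mkseq g iS.1.+1) (4 ^ iS.1) ->
      lipschitz_ball N iS.1%:R u ->
      `|mean nu (u \o ltrans w) - mean nu u| <= half ^+ iS.1].
  move=> [i S] /=; apply: amenable_almost_invariant_atom => //.
  by rewrite exprn_gt0 ?invr_gt0//= exprn_ile1 ?invr_ge0// invf_le1// ler1n.
pose S := fix S n := if n is n'.+1 then S n' ++ map snd (pick (n', S n')) else [::].
have SS m i : (m <= i)%N -> {subset S m <= S i}.
  move=> /subnK <-; elim: (i - m)%N => // k IH w wS.
  by rewrite addSn /= mem_cat IH.
exists (fun i => pick (i, S i)), S; split.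
- by move=> i; have [] := pickP (i, S i).
- by move=> i; have [] := pickP (i, S i).
- move=> m i p im pp; apply: (SS i.+1) => //=.
  by rewrite mem_cat; apply/orP; right; apply/mapP; exists p.
- move=> m i w u mi wm uL; have [_ _ H] := pickP (i, S i); apply: H => //=.
  apply: words_sub wm; first exact: SS.
    by move=> x /mapP[k]; rewrite mem_iota/= => km ->; apply: map_f; rewrite mem_iota/= (leq_trans km).
  by rewrite leq_exp2l.
Qed.

(* Lipschitz regularisation by sup-convolution with the length function. *)
Lemma lipschitz_approximation (U : set G) (d M e : R) (r : G -> R) :
  (forall x, N x < d -> U x) -> 0 < d -> 0 <= e ->
  (forall x, `|r x| <= M) -> (forall x y, U (x * y^-1)%g -> `|r x - r y| <= e) ->
  exists2 u, lipschitz_ball N (M + e + 2 * M / d) u & forall x, `|u x - r x| <= e.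
Proof.
move=> dU d0 e0 rM rU.
have M0 : 0 <= M by apply: le_trans (rM 1%g).
(* The term [2 * M / d] makes [c * d] at least [2 * M], so that points at length [d] or more never
   raise the supremum above [r x]; [M + e] bounds the values of [u]. *)
set c := M + e + 2 * M / d.
have Md : 0 <= 2 * M / d by rewrite divr_ge0 ?mulr_ge0// ltW.
have cd : 2 * M <= c * d.
  have -> : c * d = (M + e) * d + 2 * M by rewrite /c; field; rewrite gt_eqF.
  by rewrite lerDr mulr_ge0 ?addr_ge0// ltW.
pose A x := [set r y - c * N (x * y^-1)%g | y in setT].
have c0 : 0 <= c by rewrite /c; lra.
have Ax x : A x (r x).
  by exists x => //; rewrite mulgV (length1 lN) mulr0 subr0.
have ubA x : ubound (A x) (r x + e).
  move=> _ [y _ <-]; have [Nd|dN] := ltP (N (x * y^-1)%g) d.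
    have := rU _ _ (dU _ Nd); have : 0 <= c * N (x * y^-1)%g by rewrite mulr_ge0// (length_ge0 lN).
    by rewrite ler_norml => ? /andP[]; lra.
  have : c * d <= c * N (x * y^-1)%g by rewrite ler_wpM2l.
  by have := rM x; have := rM y; rewrite !ler_norml => /andP[? ?] /andP[? ?]; lra.
have supA x : has_sup (A x) by split; [exists (r x)|exists (r x + e)].
pose u x := sup (A x).
have ur x : r x <= u x <= r x + e.
  apply/andP; split; first by apply: ub_le_sup => //; case: (supA x).
  by apply: ge_sup => //; case: (supA x).
have uL x y : u x <= u y + c * N (x * y^-1)%g.
  apply: ge_sup; first by case: (supA x).
  move=> _ [z _ <-].
  have : r z - c * N (y * z^-1)%g <= u y.
    by apply: ub_le_sup; [case: (supA y)|exists z].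
  have : c * N (y * z^-1)%g <= c * (N (x * y^-1)%g + N (x * z^-1)%g).
    rewrite ler_wpM2l// -(lengthV lN (x * y^-1)%g) (le_trans _ (lengthM lN _ _))//.
    by rewrite invgM invgK mulgA mulgVK.
  rewrite mulrDr.
  lra.
exists u.
  split => [x|x y].
    have := rM x; have := ur x; rewrite !ler_norml => /andP[? ?] /andP[? ?].
    by apply/andP; split; rewrite /c; lra.
  rewrite ler_norml; apply/andP; split; last by have := uL x y; lra.
  have := uL y x; rewrite -(lengthV lN (y * x^-1)%g) invgM invgK; lra.
move=> x; have /andP[? ?] := ur x; rewrite ler_norml; apply/andP; split; lra.
Qed.

End construction.

(** * Convergence to invariance *)

Section amenable_random_walk.
Local Open Scope complex_scope.
Context (R : realType) (G : topologicalGroupType).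
Hypothesis scG : @second_countable G.
Local Notation half := (2^-1 : R).
Local Notation Re := complex.Re.
Local Notation Im := complex.Im.

Lemma ReB : {morph @Re R : z w / z - w}. Proof. by case=> ? ? [? ?]. Qed.
Lemma ImB : {morph @Im R : z w / z - w}. Proof. by case=> ? ? [? ?]. Qed.

Lemma lipschitz_ball_continuous (N : G -> R) c u : length_function N -> 0 <= c ->
  lipschitz_ball N c u -> continuous u.
Proof.
move=> lN c0 uL.
exact: (RUCB_part_continuous ReB (@ler_Re_normc R) (lipschitz_ball_RUCB lN c0 uL)).
Qed.

Section asymptotic.
Variables (N : G -> R) (g : nat -> G) (nu : nat -> seq (R * G)) (S : nat -> seq G).
Variable mu : probability (borel G) R.
Hypothesis lN : length_function N.
Hypothesis Nnbhs : forall U, nbhs 1%g U -> exists2 d, 0 < d & forall x, N x < d -> U x.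
Hypothesis gdense : forall (x : G) (U : set G), nbhs x U -> exists n, U (g n).
Hypothesis fnu : forall i, finite_prob (nu i).
Hypothesis nuS : forall m i p, (i < m)%N -> p \in nu i -> p.2 \in S m.
Hypothesis nuP : forall m i w u, (m <= i)%N ->
  w \in words (S m) (mkseq g m.+1) (4 ^ m) -> lipschitz_ball N i%:R u ->
  `|mean (nu i) (u \o ltrans w) - mean (nu i) u| <= half ^+ i.
Hypothesis muP : forall (h : borel G -> R) c m b e, measurable_fun setT h ->
  (forall x, `|h x| <= c) ->
  (forall i, (i < m)%N -> `|mean (nu i) h| <= b) ->
  (forall i, (m <= i)%N -> `|mean (nu i) h| <= e) ->
  `|\int[mu]_x h x| <= (1 - half ^+ m) * b + half ^+ m * e.

Let L n (f : G -> R) := \int[convolution_power scG mu n]_x f x.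

(** In the Bernoulli estimate with a = 2^-m and [4 ^ m] factors, na = 2^m, so the power is at most 1
    / (1 + 2^m). This is what the word length [4 ^ m] is chosen for. *)
Lemma expr_1Bhalf_le m : (1 - half ^+ m) ^+ (4 ^ m) <= half ^+ m.
Proof.
have a0 : 0 < half ^+ m by rewrite exprn_gt0 ?invr_gt0.
have a1 : half ^+ m <= 1 by rewrite exprn_ile1 ?invr_ge0// invf_le1// ler1n.
have := @expr_1B_le R (half ^+ m) (4 ^ m)%N; rewrite (ltW a0) a1 => /(_ isT).
have -> : (4 ^ m)%:R * half ^+ m = (half ^+ m)^-1.
  have h2 : 4 * 2^-1 = 2 :> R by lra.
  by rewrite natrX -exprMn h2 exprVn invrK.
move=> h; rewrite -[leRHS]mul1r -ler_pdivrMr//; apply: le_trans h.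
by rewrite ler_wpM2l ?lerDr ?exprn_ge0 ?subr_ge0.
Qed.

(** The decay estimate for the initial words [g k] and [1] with [4 ^ m] steps: meeting no late step
    contributes at most [2 * c] times 2^-m, the defect of invariance twice 2^-m. *)
Lemma lipschitz_ball_decay c u k m n : 0 <= c -> lipschitz_ball N c u ->
  c <= m%:R -> (k <= m)%N -> (4 ^ m <= n)%N ->
  `|L n (fun x => u (g k * x)%g - u x)| <= 2 * (c + 1) * half ^+ m.
Proof.
move=> c0 uL cm km mn.
pose W j := [set w | w \in words (S m) (mkseq g m.+1) j].
have WS j w i p : (i < m)%N -> p \in nu i -> W j w -> W j.+1 (w * p.2)%g.
  move=> im pnu wj; rewrite /W/= mem_cat; apply/orP; right.
  by apply/allpairsP; exists (w, p.2); split => //=; exact: nuS pnu.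
have ue i j w y : (m <= i)%N -> (j <= 4 ^ m)%N -> W j w ->
    `|mean (nu i) (fun x => u (w * x * y)%g) - mean (nu i) (fun x => u (x * y)%g)| <= half ^+ m.
  move=> mi jm wj.
  (* Right translations stay in the ball, and [c <= m <= i] places [u] in the ball on which [nu i]
     is almost invariant. *)
  have uLy : lipschitz_ball N i%:R (fun x => u (x * y)%g).
    apply: lipschitz_ball_rtrans; apply: lipschitz_ball_le uL => //.
    by rewrite (le_trans cm)// ler_nat.
  have wm : w \in words (S m) (mkseq g m.+1) (4 ^ m) by exact: words_sub wj.
  apply: le_trans (nuP mi wm uLy) _.
  by apply: ler_wiXn2l => //; rewrite ?invr_ge0// invf_le1// ler1n.
have W1 : W 0%N 1%g by rewrite /W/= inE eqxx.
have Wk : W 0%N (g k).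
  by rewrite /W/= inE; apply/orP; right; apply: map_f; rewrite mem_iota.
have cu := lipschitz_ball_continuous lN c0 uL.
have muPm (h : borel G -> R) c' b e := @muP h c' m b e.
have H := @convolution_power_decay R G scG mu nu m fnu muPm W (4 ^ m)%N u c
  (half ^+ m) WS cu uL.1 ue (4 ^ m)%N n 0%N (g k) 1%g mn (leqnn _) Wk W1.
have -> : (fun x => u (g k * x)%g - u x) = (fun x => u (g k * x)%g - u (1 * x)%g).
  by apply/funext => x; rewrite mul1g.
apply: le_trans H _.
have := expr_1Bhalf_le m; have : 0 <= 2 * c by lra.
by move=> c2 /(ler_wpM2l c2); lra.
Qed.

(** Replacing [r] by a Lipschitz [u] within [e] costs [2 * e], moving [h] to a nearby [g k] costs
    [e], and the decay for [u] another [e]. The threshold is fixed before [r], hence uniform over a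
    UEB set. *)
Lemma convolution_power_asymptotic (h : G) (M e : R) U : 0 < e -> nbhs 1%g U ->
  exists n0, forall n r, (n0 <= n)%N -> continuous r -> (forall x, `|r x| <= M) ->
    (forall x y, U (x * y^-1)%g -> `|r x - r y| <= e) ->
    `|L n (r \o ltrans h) - L n r| <= 4 * e.
Proof.
move=> e0 nU; have [d d0 dU] := Nnbhs nU.
have [k Uk] : exists k, U (h * (g k)^-1)%g.
  apply: (gdense (x := h) (U := [set x | U (h * x^-1)%g])).
  have c : continuous (fun x : G => (h * x^-1)%g).
    by move=> x; apply: continuous_comp; [exact: invg_continuous|exact: continuous_ltrans].
  by apply: c; rewrite mulgV.
pose c := `|M| + e + 2 * `|M| / d.
have c0 : 0 <= c by rewrite !addr_ge0 ?divr_ge0 ?mulr_ge0// ltW.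
have [m [cm km me]] : exists m, [/\ c <= m%:R, (k <= m)%N & 2 * (c + 1) * half ^+ m <= e].
  have c1 : 0 < 2 * (c + 1) by lra.
  near \oo => m; exists m; split; near: m.
  - exact: nbhs_infty_ger.
  - exact: nbhs_infty_ge.
  - move/cvgrPdist_le : (@cvg_half R) => /(_ _ (divr_gt0 e0 c1)); apply: filterS => m.
    by rewrite sub0r normrN ger0_norm ?exprn_ge0 ?invr_ge0// ler_pdivlMr// mulrC.
exists (4 ^ m)%N => n r mn cr rM rU.
have rM' x : `|r x| <= `|M| by rewrite (le_trans (rM x))// ler_norm.
have [u uL ur] := lipschitz_approximation lN dU d0 (ltW e0) rM' rU.
have cu := lipschitz_ball_continuous lN c0 uL.
have meas (v : G -> R) : continuous v -> measurable_fun setT (v : borel G -> R).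
  exact: continuous_borel_measurable.
have ctr (v : G -> R) x : continuous v -> continuous (v \o ltrans x).
  by move=> cv y; apply: continuous_comp; [exact: continuous_ltrans|exact: cv].
pose P := convolution_power scG mu n.
have ir : P.-integrable setT (EFin \o r).
  by apply: (probability_bounded_integrable _ (meas _ cr) rM).
have irh : P.-integrable setT (EFin \o (r \o ltrans h)).
  by apply: (probability_bounded_integrable _ (meas _ (ctr _ h cr)) (fun x => rM (ltrans h x))).
pose v x := u (g k * x)%g - u x.
have cv : continuous v by move=> x; apply: continuousB; [exact: (ctr u (g k) cu)|exact: cu].
have vb x : `|v x| <= c + c by rewrite (le_trans (ler_normB _ _))// lerD// uL.1.
have iv : P.-integrable setT (EFin \o v).
  exact: (probability_bounded_integrable _ (meas _ cv) vb).
pose D x := (r \o ltrans h) x - r x - v x.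
have cD : continuous D.
  have c1 : continuous (fun x => (r \o ltrans h) x - r x).
    by move=> x; apply: continuousB; [exact: ctr|exact: cr].
  by move=> x; exact: (continuousB (c1 x) (cv x)).
have Db x : `|D x| <= 3 * e.
  have -> : D x = (r (h * x)%g - r (g k * x)%g) - (u (g k * x)%g - r (g k * x)%g) + (u x - r x).
    by rewrite /D /v /= /ltrans; ring.
  have := rU (h * x)%g (g k * x)%g; rewrite invgM mulgA mulgK => /(_ Uk).
  have := ur (g k * x)%g; have := ur x.
  set A := u x - _; set B := u _ - _; set C := r _ - _ => hA hB hC.
  rewrite (le_trans (ler_normD _ _))// (le_trans (lerD (ler_normB _ _) (lexx _)))//; lra.
have -> : L n (r \o ltrans h) - L n r = L n v + L n D.
  rewrite /L -RintegralB// -RintegralD//.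
    by apply: eq_Rintegral => x _; rewrite /D [RHS]addrC subrK.
  exact: (probability_bounded_integrable _ (meas _ cD) Db).
rewrite (le_trans (ler_normD _ _))//.
have := norm_probability_integral_le P (meas _ cD) Db.
have := lipschitz_ball_decay c0 uL cm km mn.
rewrite -/(L n _) -/v; move: me; lra.
Unshelve. all: by end_near. Qed.

Lemma convolution_power_UEB_converges : UEB_converges_to_invariance \oo
  (fun n => measure_state (convolution_power scG mu n)).
Proof.
move=> h H [HR [M HM] He]; apply/cvgrPdist_le => e e0.
(* Real and imaginary parts each contribute 4 * (e / 8), together [e]. *)
have e8 : 0 < e / 8 by rewrite divr_gt0.
have [U nU HU] := He _ e8.
have [n0 n0P] := convolution_power_asymptotic h M e8 nU.
exists n0 => // n n0n; rewrite sub0r normrN.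
set A := [set _ | _ in _].
have Ae z : A z -> 0 <= z <= e.
  move=> [f Hf <-]; apply/andP; split; [exact: normc_ge0|apply: (le_trans (normc_le _))].
  have part (p : R[i] -> R) : {morph p : z w / z - w} -> (forall z, `|p z| <= normc z) ->
      `|L n ((p \o f) \o ltrans h) - L n (p \o f)| <= 4 * (e / 8).
    move=> pB pn; apply: n0P => //.
    - exact: RUCB_part_continuous (HR _ Hf).
    - by move=> x; rewrite (le_trans (pn _))// HM.
    - by move=> x y Uxy; rewrite /= -pB (le_trans (pn _))// HU.
  have := part _ ReB (@ler_Re_normc R); have := part _ ImB (@ler_Im_normc R).
  rewrite /= /integralC /L /=; lra.
(* An empty [H] gives the supremum 0 by convention; otherwise the supremum is trapped between 0 and
   [e]. *)
have [->|/set0P[z Az]] := eqVneq A set0; first by rewrite sup0 normr0 ltW.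
have supA : has_sup A by split; [exists z|exists e => y /Ae /andP[]].
rewrite ger0_norm.
  by apply: ge_sup; [exists z|move=> y /Ae /andP[]].
have /andP[z0 _] := Ae _ Az; apply: (le_trans z0).
by apply: ub_le_sup => //; case: supA.
Qed.

End asymptotic.

(** * Support and regularity of the countable mixture *)

Section atomic_measure.
Variables (nu : nat -> seq (R * G)) (mu : probability (borel G) R).
Hypothesis fnu : forall i, finite_prob (nu i).
Hypothesis muE : forall A : set (borel G),
  (mu A = \sum_(0 <= i <oo) (half ^+ i.+1 * mean (nu i) \1_A)%:E)%E.

Let term_ge0 (A : set (borel G)) i : (0 <= (half ^+ i.+1 * mean (nu i) \1_A)%:E)%E.
Proof.
rewrite lee_fin mulr_ge0 ?(ltW (half_gt0 _))// -[leLHS](mean_cst 0 (fnu i)).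
by apply: le_mean => // p _; rewrite indicE ler0n.
Qed.

(** A nonempty open set contains some [g n], whose mass under [nu n] already makes one term of the
    series positive. *)
Lemma atomic_fully_supported (g : nat -> G) :
  (forall (x : G) (U : set G), nbhs x U -> exists n, U (g n)) ->
  (forall i, exists2 a, 0 < a & (a, g i) \in nu i) -> fully_supported mu.
Proof.
move=> gdense gnu; apply/seteqP; split => // x _ U oU Ux.
have [n Un] : exists n, U (g n) by apply: (gdense x); exact: open_nbhs_nbhs.
have [a a0 anu] := gnu n.
rewrite muE; apply: lt_le_trans (nneseries_lim_ge n.+1 _); last by move=> *; exact: term_ge0.
rewrite big_nat_recr//=.
apply: (@lt_le_trans _ _ (half ^+ n.+1 * mean (nu n) \1_U)%:E); last first.
  by rewrite leeDr// sume_ge0// => i _; exact: term_ge0.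
rewrite lte_fin mulr_gt0 ?half_gt0// /mean (big_rem _ anu)/=.
rewrite indicE mem_set// mulr1 ltr_wpDr// big_seq sumr_ge0// => p /mem_rem pnu.
by rewrite mulr_ge0 ?(fnu n).1// indicE.
Qed.

(** Inner approximation by finite sets: the first [n] terms of the series only see the atoms of
    [nu i] for [i < n], so intersecting [B] with this finite set preserves their values. *)
Lemma atomic_regular : regular_measure mu.
Proof.
move=> B _; have mu_mono (A C : set (borel G)) : A `<=` C -> (mu A <= mu C)%E.
  move=> AC; rewrite !muE; apply: lee_nneseries => [i _ _|i _]; first exact: term_ge0.
  rewrite lee_fin ler_pM2l ?half_gt0//; apply: le_mean => // p _.
  by rewrite !indicE; case: (boolP (p.2 \in A)) => [/set_mem/AC/mem_set ->|_]; rewrite ?ler0n.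
apply/le_anti/andP; split; last first.
  by apply: ge_ereal_sup => _ [K [_ KB] <-]; exact: mu_mono.
rewrite {1}muE; apply: lime_le.
  by apply: is_cvg_nneseries => i _ _; exact: term_ge0.
near=> n.
pose pts := flatten [seq map snd (nu i) | i <- iota 0 n].
pose K : set G := B `&` [set` pts].
apply: (@le_trans _ _ (mu K)).
  rewrite muE; apply: le_trans (nneseries_lim_ge n _); last by move=> *; exact: term_ge0.
  rewrite big_nat [leRHS]big_nat; apply: lee_sum => i /andP[_ iLn].
  rewrite lee_fin ler_pM2l ?half_gt0//; apply: le_mean => // p pnu.
  rewrite !indicE; case: (boolP (p.2 \in B)) => [/set_mem Bp|_]; last by rewrite ler0n.
  rewrite mem_set//; split => //; apply/flattenP; exists (map snd (nu i)); last by apply: map_f.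
  by apply: map_f; rewrite mem_iota.
apply: ereal_sup_ubound; exists K => //; split; last by move=> x [].
by apply: finite_compact; apply: finite_setIr; exact: finite_seq.
Unshelve. all: by end_near. Qed.

End atomic_measure.

Lemma amenable_exists_measure : amenable R G ->
  exists mu : probability (borel G) R,
    [/\ fully_supported mu, regular_measure mu &
       UEB_converges_to_invariance \oo
         (fun n => measure_state (convolution_power scG mu n))].
Proof.
move=> am.
have [N [lN Nnbhs]] := exists_length_function R scG.
have [g gdense] := second_countable_dense_sequence scG.
have [nu [S [fnu gnu nuS nuP]]] := exists_almost_invariant_sequence lN g am.
have [mu [muE muP]] := @atomic_probability _ (borel G) R nu fnu.
exists mu; split.
- exact: (atomic_fully_supported fnu muE gdense gnu).
- exact: (atomic_regular fnu muE).
- exact: (convolution_power_UEB_converges lN Nnbhs gdense fnu nuS nuP muP).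
Qed.

End amenable_random_walk.

(** * Limit states *)

Section limit_state.
Local Open Scope complex_scope.
Context (R : realType) (G : topologicalGroupType).
Variable P : nat -> probability (borel G) R.
Local Notation Re := (@complex.Re R).
Local Notation Im := (@complex.Im R).

(** On a bounded [f] the real and imaginary parts of the integrals stay in a segment, so they
    converge along an ultrafilter finer than [\oo]. Linearity and positivity pass to the limit, and
    the singleton of [f], a UEB set, gives invariance. *)
Lemma UEB_converges_amenable :
  UEB_converges_to_invariance \oo (fun n => measure_state (P n)) -> amenable R G.
Proof.
move=> Pinv; have [U [UU oU]] := ultraFilterLemma (F := \oo : set_system nat) _.
pose part (p : R[i] -> R) f n := p (measure_state (P n) f).
have part_cvg p : (p = Re \/ p = Im) -> forall f, RUCB f -> cvg (part p f @ U).
  move=> pE f Rf; have [[M fM] _] := Rf.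
  have bnd n : `[- M, M]%classic (part p f n).
    have meas q : {morph q : z w / z - w} -> (forall z : R[i], `|q z| <= normc z) ->
        `|\int[P n]_x q (f x)| <= M.
      move=> qB qn; apply: norm_probability_integral_le => [|x].
        apply: (continuous_borel_measurable (f := q \o f)).
        exact: RUCB_part_continuous.
      by rewrite (le_trans (qn _)).
    rewrite /= in_itv/= -ler_norml.
    by case: pE => ->; apply: meas; [exact: ReB|exact: ler_Re_normc|exact: ImB|exact: ler_Im_normc].
  have [|l [_ cl]] := @segment_compact R (- M) M (part p f @ U) _.
  - by apply: (@filterE _ U) => n; exact: bnd.
  - apply/cvg_ex; exists l => V Vl.
    (* For an ultrafilter a cluster point is a limit: [V] or its complement has its preimage in [U],
       and the complement would contradict clustering at [V]. *)
    have [//|nV] := in_ultra_setVsetC (part p f @^-1` V) UU.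
    by have [x [nVx Vx]] := cl (~` V) V nV Vl.
have Re_cvg := part_cvg _ (or_introl erefl).
have Im_cvg := part_cvg _ (or_intror erefl).
pose nu f : R[i] := lim (part Re f @ U) +i* lim (part Im f @ U).
have nu_lin a f h : RUCB f -> RUCB h -> nu (fun x => a * f x + h x) = a * nu f + nu h.
  move=> Rf Rh; rewrite /nu; case: a => a b.
  have E n : measure_state (P n) (fun x => (a +i* b) * f x + h x) =
    (a +i* b) * measure_state (P n) f + measure_state (P n) h by exact: stateP.
  apply/eqP; rewrite eq_complex /=; apply/andP; split; apply/eqP; apply/cvg_lim => //.
  - rewrite (_ : part _ _ = (fun n => a * part Re f n - b * part Im f n + part Re h n)).
      apply: cvgD; last exact: Re_cvg.
      by apply: cvgB; apply: cvgMr; [exact: Re_cvg|exact: Im_cvg].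
    by apply/funext => n; rewrite /part E /=.
  - rewrite (_ : part _ _ = (fun n => a * part Im f n + b * part Re f n + part Im h n)).
      apply: cvgD; last exact: Im_cvg.
      by apply: cvgD; apply: cvgMr; [exact: Im_cvg|exact: Re_cvg].
    by apply/funext => n; rewrite /part E /=.
have lim_part p f l : (forall n, part p f n = l) -> lim (part p f @ U) = l.
  move=> H; apply/cvg_lim => //; rewrite (_ : part p f = fun=> l); last exact/funext.
  exact: cvg_cst.
have nu_ge0 f : RUCB f -> (forall x, 0 <= f x) -> 0 <= nu f.
  move=> Rf f0; have H n := state_ge0 (measure_state (P n)) Rf f0.
  rewrite lecE /=; apply/andP; split.
    by rewrite (lim_part _ _ 0)// => n; rewrite /part ger0_Im.
  apply: limr_ge; first exact: Re_cvg.
  by near=> n; have := H n; rewrite lecE => /andP[].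
have nu1 : nu (fun=> 1) = 1.
  by rewrite /nu (lim_part _ _ 1) ?(lim_part _ _ 0)// => n; rewrite /part state1.
exists (State nu_lin nu_ge0 nu1) => f g Rf; have [[M fM] uf] := Rf.
have RH : RUEB [set f].
  split=> [_ -> //||e e0]; first by exists M => _ x ->.
  by have [V nV fV] := uf _ e0; exists V => // _ x y ->; exact: fV.
have := Pinv g _ RH.
under eq_fun do rewrite image_set1 sup1.
move=> /(cvg_trans (cvg_app _ oU)) d0.
have lim_eq p : (p = Re \/ p = Im) -> (forall z w, p (z - w) = p z - p w) ->
    (forall z, `|p z| <= normc z) ->
    lim (part p (f \o ltrans g) @ U) = lim (part p f @ U).
  move=> pE pB pn; apply/eqP; rewrite -subr_eq0; apply/eqP.
  have c1 := part_cvg p pE _ (RUCB_ltrans g Rf).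
  have c2 := part_cvg p pE _ Rf.
  rewrite -limB//; apply/cvg_lim => //.
  apply: norm_cvg0; apply: (squeeze_cvgr _ (cvg_cst 0) d0).
  near=> n; apply/andP; split; first exact: normr_ge0.
  have := pn (measure_state (P n) (f \o ltrans g) - measure_state (P n) f).
  by rewrite pB.
congr (_ +i* _).
  exact: (lim_eq _ (or_introl erefl) (@ReB R) (@ler_Re_normc R)).
exact: (lim_eq _ (or_intror erefl) (@ImB R) (@ler_Im_normc R)).
Unshelve. all: by end_near. Qed.

End limit_state.

Theorem theorem4p7 (R : realType) (G : topologicalGroupType)
    (hausdorffG : hausdorff_space G) (scG : @second_countable G) :
  [<-> amenable R G ;
       exists mu : probability (borel G) R,
         [/\ fully_supported mu, regular_measure mu &
             UEB_converges_to_invariance \oo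
               (fun n => measure_state (convolution_power scG mu n))] ;
       exists mu : probability (borel G) R,
         UEB_converges_to_invariance \oo
           (fun n => measure_state (convolution_power scG mu n))].
Proof.
tfae.
- exact: amenable_exists_measure.
- by move=> [mu [_ _ muinv]]; exists mu.
- by move=> [mu muinv]; exact: UEB_converges_amenable muinv.
Qed.
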